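(* Let $\Lambda$ be a $k$-graph and let $A$ be an abelian group. The homomorphism $\psi:H^2(\Lambda,A)\to\underline{H}^2(\Lambda,A)$ given by $[\phi]\mapsto[c_\phi]$ is an isomorphism.
   Context: $k$-graphs. For a nonnegative integer $k$, a $k$-graph is a nonempty countable small category $\Lambda$ with a functor $d:\Lambda\to\mathbb{N}^k$ (the degree; $0\in\mathbb{N}$) with the factorisation property: whenever $d(\lambda)=m+n$ with $m,n\in\mathbb N^k$ there are unique $\mu,\nu\in\Lambda$ with $d(\mu)=m$, $d(\nu)=n$, $\lambda=\mu\nu$. Write $\Lambda^n=d^{-1}(n)$. The set $\Lambda^0$ is identified with the set of objects (identity morphisms), and $r,s:\Lambda\to\Lambda^0$ are codomain and domain; $\mu\nu$ is defined iff $s(\mu)=r(\nu)$. Let $e_1,\dots,e_k$ be the generators of $\mathbb{N}^k$, $|n|=\sum_i n_i$ and $|\lambda|=|d(\lambda)|$. Cubical cohomology. Let $Q_r(\Lambda)=\{\lambda\in\Lambda: d(\lambda)\le(1,\dots,1),\ |\lambda|=r\}$ (empty for $r>k$). If $\lambda\in Q_r(\Lambda)$ has $d(\lambda)=e_{i_1}+\cdots+e_{i_r}$ with $i_1<\cdots<i_r$, then for $1\le j\le r$, $F_j^0(\lambda),F_j^1(\lambda)$ are the unique elements of $\Lambda^{d(\lambda)-e_{i_j}}$ such that $\lambda=F_j^0(\lambda)\beta=\alpha F_j^1(\lambda)$ for some $\alpha,\beta\in\Lambda^{e_{i_j}}$. $C^r(\Lambda,A)$ is the group of all functions $Q_r(\Lambda)\to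 A$, and $(\delta^r f)(\lambda)=\sum_{i=1}^{r+1}\sum_{\ell=0}^1(-1)^{i+\ell}f(F_i^\ell(\lambda))$ for $\lambda\in Q_{r+1}(\Lambda)$. Put $Z^2=\ker\delta^2$, $B^2=\operatorname{Im}\delta^{1}$, $H^2=Z^2/B^2$. Categorical cohomology. For $r\ge1$, $\Lambda^{*r}$ is the set of composable $r$-tuples $(\lambda_1,\dots,\lambda_r)$ ($s(\lambda_i)=r(\lambda_{i+1})$). $\underline{C}^r(\Lambda,A)$ is the group of functions $f:\Lambda^{*r}\to A$ with $f(\lambda_1,\dots,\lambda_r)=0$ whenever some $\lambda_i\in\Lambda^0$. For $r\ge1$, $(\underline{\delta}^rf)(\lambda_0,\dots,\lambda_r)=f(\lambda_1,\dots,\lambda_r)+\sum_{i=1}^r(-1)^if(\lambda_0,\dots,\lambda_{i-2},\lambda_{i-1}\lambda_i,\lambda_{i+1},\dots,\lambda_r)+(-1)^{r+1}f(\lambda_0,\dots,\lambda_{r-1})$. Put $\underline{Z}^2=\ker\underline{\delta}^2$, $\underline{B}^2=\operatorname{Im}\underline{\delta}^{1}$, $\underline{H}^2=\underline{Z}^2/\underline{B}^2$. The cocycle $c_\phi$. Let $E_\Lambda$ be the path category of the directed graph with vertex set $\Lambda^0$, edge set $Q_1(\Lambda)=\bigcup_i\Lambda^{e_i}$, and $r,s$ inherited from $\Lambda$: its elements are the vertices and the formal strings $u=u_1\cdots u_n$ of edges with $s(u_i)=r(u_{i+1})$. For an edge $e\in\Lambda^{e_i}$ put $C(e)=i$. Let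 $\pi:E_\Lambda\to\Lambda$ be the functor that composes the edges of a string in $\Lambda$ (identity on vertices). For $\lambda\in\Lambda$, $\overline{\lambda}\in E_\Lambda$ is the unique path $\overline{\lambda}_1\cdots\overline{\lambda}_{|\lambda|}$ with $\pi(\overline{\lambda})=\lambda$ and $C(\overline{\lambda}_i)\le C(\overline{\lambda}_{i+1})$ for all $i$. An allowable transition is a pair $(u,w)\in E_\Lambda\times E_\Lambda$ with $\pi(u)=\pi(w)$ for which there is $i$ with $u_j=w_j$ for $j\notin\{i,i+1\}$ and $C(w_{i+1})=C(u_i)<C(u_{i+1})=C(w_i)$; for $\phi\in Z^2(\Lambda,A)$ put $\tilde\phi(u,w)=\phi(\pi(u_iu_{i+1}))$. For each $w\in E_\Lambda$ there is a finite sequence $w=w^0,w^1,\dots,w^n=\overline{\pi(w)}$ with every $(w^j,w^{j-1})$ an allowable transition; $S_\phi(w):=\sum_{j=1}^n\tilde\phi(w^j,w^{j-1})$ does not depend on the chosen sequence. Define $c_\phi:\Lambda^{*2}\to A$ by $c_\phi(\mu,\nu)=S_\phi(\overline{\mu}\,\overline{\nu})$. Then $c_\phi\in\underline{Z}^2(\Lambda,A)$, and $[\phi]\mapsto[c_\phi]$ is a well-defined homomorphism $\psi:H^2(\Lambda,A)\to\underline{H}^2(\Lambda,A)$. *)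

(* Defs.v *)
From HB Require Import structures.
From mathcomp Require Import all_boot all_order all_algebra.
From mathcomp Require Import boolp classical_sets functions cardinality.
From mathcomp Require Import zify.

Set Implicit Arguments.
Unset Strict Implicit.
Unset Printing Implicit Defensive.

Import Order.TTheory GRing.Theory Num.Theory.
Local Open Scope ring_scope.
Local Open Scope quotient_scope.

(* The category is given by its objects and its (untyped) morphisms; [comp]   *)
(* is total, but [comp mu nu] is only meaningful, and all the axioms only     *)
(* apply, when [src mu = rng nu].                                             *)
Record kgraph (k : nat) := KGraph {
  obj : Type;
  mor : Type;
  rng : mor -> obj;
  src : mor -> obj;
  idm : obj -> mor;
  comp : mor -> mor -> mor;
  deg : mor -> {ffun 'I_k -> nat};
  rng_idm : forall v, rng (idm v) = v;
  src_idm : forall v, src (idm v) = v;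
  rng_comp : forall m n, src m = rng n -> rng (comp m n) = rng m;
  src_comp : forall m n, src m = rng n -> src (comp m n) = src n;
  comp_idl : forall m, comp (idm (rng m)) m = m;
  comp_idr : forall m, comp m (idm (src m)) = m;
  comp_assoc : forall l m n, src l = rng m -> src m = rng n ->
    comp l (comp m n) = comp (comp l m) n;
  deg_idm : forall v, deg (idm v) = 0;
  deg_comp : forall m n, src m = rng n -> deg (comp m n) = deg m + deg n;
  factorisation : forall l (m n : {ffun 'I_k -> nat}), deg l = m + n ->
    exists! p : mor * mor,
      [/\ src p.1 = rng p.2, deg p.1 = m, deg p.2 = n & comp p.1 p.2 = l];
  kgraph_nonempty : inhabited obj;
  kgraph_countable : countable [set: mor]
}.

Arguments idm {k} L v : rename.

Section Factorisation.
Variables (k : nat) (L : kgraph k).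
Implicit Types (l : mor L) (m n : {ffun 'I_k -> nat}).

Definition unit_deg (i : 'I_k) : {ffun 'I_k -> nat} := [ffun j => (i == j) : nat].

Definition deg_sub m n : {ffun 'I_k -> nat} := [ffun i => (m i - n i)%N].

Definition total_deg l : nat := (\sum_i deg l i)%N.

Definition factor l m n (e : deg l = m + n) : mor L * mor L :=
  projT1 (cid (factorisation e)).

Lemma factorP l m n (e : deg l = m + n) :
  [/\ src (factor e).1 = rng (factor e).2, deg (factor e).1 = m,
      deg (factor e).2 = n & comp (factor e).1 (factor e).2 = l].
Proof. by have [H _] := projT2 (cid (factorisation e)). Qed.

Lemma factor_uniq (a b a' b' : mor L) :
  src a = rng b -> src a' = rng b' -> deg a = deg a' -> deg b = deg b' ->
  comp a b = comp a' b' -> a = a' /\ b = b'.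
Proof.
move=> ab ab' da db E.
have [p [_ Hp]] := factorisation (deg_comp ab).
have pE := Hp (a, b) (And4 ab erefl erefl erefl).
have pE' := Hp (a', b') (And4 ab' (esym da) (esym db) (esym E)).
by have [-> ->] := etrans (esym pE) pE'.
Qed.

Lemma deg0_idm l : deg l = 0 -> l = idm L (rng l).
Proof.
move=> d0.
suff [] : l = idm L (rng l) /\ idm L (src l) = l by [].
apply: factor_uniq; rewrite ?rng_idm ?src_idm ?deg_idm //.
by rewrite comp_idl comp_idr.
Qed.

Lemma comp_deg0l (a b : mor L) : src a = rng b -> deg a = 0 -> comp a b = b.
Proof. by move=> ab /deg0_idm E; move: ab; rewrite E src_idm => ->; rewrite comp_idl. Qed.

Lemma comp_deg0r (a b : mor L) : src a = rng b -> deg b = 0 -> comp a b = a.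
Proof. by move=> ab /deg0_idm E; rewrite E -ab comp_idr. Qed.

Lemma deg_subK l (i : 'I_k) : (0 < deg l i)%N ->
  deg l = deg_sub (deg l) (unit_deg i) + unit_deg i.
Proof.
move=> li; apply/ffunP => j; rewrite !ffunE; case: eqP => [<-|_] /=.
  by rewrite [RHS]subnK.
by rewrite [RHS]addn0 subn0.
Qed.

Lemma deg_subKl l (i : 'I_k) : (0 < deg l i)%N ->
  deg l = unit_deg i + deg_sub (deg l) (unit_deg i).
Proof. by move=> /deg_subK; rewrite addrC. Qed.

Lemma total_deg_sub l l' (i : 'I_k) : (0 < deg l i)%N ->
  deg l' = deg_sub (deg l) (unit_deg i) -> total_deg l = (total_deg l').+1.
Proof.
move=> li E; rewrite /total_deg (bigD1 i) //= [in RHS](bigD1 i) //= E !ffunE eqxx.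
rewrite -addSn subn1 prednK //; congr addn; apply: eq_bigr => j /negbTE ji.
by rewrite !ffunE eq_sym ji subn0.
Qed.

End Factorisation.

Section Cubical.
Variables (k : nat) (L : kgraph k).

Definition is_cube (r : nat) (l : mor L) : bool :=
  [forall i, (deg l i <= 1)%N] && (total_deg l == r).

Definition cube (r : nat) : Type := {l : mor L | is_cube r l}.

Definition cube_dirs r (x : cube r) : pred 'I_k := [pred i | deg (sval x) i == 1%N].

Lemma card_cube_dirs r (x : cube r) : #|cube_dirs x| = r.
Proof.
case/andP: (svalP x) => /forallP x1 /eqP {2}<-.
rewrite /total_deg -sum1_card [RHS](bigID (mem (cube_dirs x))) /=.
rewrite [X in _ = (_ + X)%N]big1 ?addn0.
  by apply: eq_bigr => i; rewrite inE /= => /eqP ->.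
by move=> i; rewrite inE /=; have := x1 i; case: (deg _ i) => [|[]].
Qed.

(* The directions [i_1 < ... < i_r] of a cube: [enum_val] enumerates ['I_k]   *)
(* increasingly, and [cube_dir x j] is the paper's [i_(j+1)].                 *)
Definition cube_dir r (x : cube r) (j : 'I_r) : 'I_k :=
  enum_val (cast_ord (esym (card_cube_dirs x)) j).

Lemma cube_dirP r (x : cube r) (j : 'I_r) : deg (sval x) (cube_dir x j) = 1%N.
Proof. by apply/eqP; have := enum_valP (cast_ord (esym (card_cube_dirs x)) j). Qed.

Lemma cube_dir_gt0 r (x : cube r) (j : 'I_r) :
  (0 < deg (sval x) (cube_dir x j))%N.
Proof. by rewrite cube_dirP. Qed.

(* [x = F_j^0(x) beta] for [l = false] and [x = alpha F_j^1(x)] for           *)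
(* [l = true], with [alpha] and [beta] of degree [e_(i_j)].                   *)
Definition face_mor r (x : cube r) (j : 'I_r) (l : bool) : mor L :=
  if l then (factor (deg_subKl (cube_dir_gt0 x j))).2
  else (factor (deg_subK (cube_dir_gt0 x j))).1.

Lemma deg_face_mor r (x : cube r) (j : 'I_r) l :
  deg (face_mor x j l) = deg_sub (deg (sval x)) (unit_deg (cube_dir x j)).
Proof.
case: l; first by case: (factorP (deg_subKl (cube_dir_gt0 x j))).
by case: (factorP (deg_subK (cube_dir_gt0 x j))).
Qed.

Lemma face_cube r (x : cube r.+1) (j : 'I_r.+1) l : is_cube r (face_mor x j l).
Proof.
have dE := deg_face_mor x j l.
have := total_deg_sub (cube_dir_gt0 x j) dE.
case/andP: (svalP x) => /forallP x1 /eqP -> [dr].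
rewrite /is_cube -dr eqxx andbT; apply/forallP => i; rewrite dE ffunE.
exact: leq_trans (leq_subr _ _) (x1 i).
Qed.

Definition face r (x : cube r.+1) (j : 'I_r.+1) (l : bool) : cube r :=
  exist _ (face_mor x j l) (face_cube x j l).

Lemma face0P r (x : cube r.+1) (j : 'I_r.+1) (y : mor L) :
  y = sval (face x j false) <->
  deg y = deg_sub (deg (sval x)) (unit_deg (cube_dir x j)) /\
  exists beta, [/\ deg beta = unit_deg (cube_dir x j), src y = rng beta
                 & sval x = comp y beta].
Proof.
rewrite /face /face_mor /=; have [s d1 d2 E] := factorP (deg_subK (cube_dir_gt0 x j)).
split=> [->|[dy [b [db sb Eb]]]].
  by split=> //; exists (factor (deg_subK (cube_dir_gt0 x j))).2.
by have [] := @factor_uniq _ _ y b _ _ sb s; rewrite ?dy ?db ?d1 ?d2 ?E ?Eb.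
Qed.

Lemma face1P r (x : cube r.+1) (j : 'I_r.+1) (y : mor L) :
  y = sval (face x j true) <->
  deg y = deg_sub (deg (sval x)) (unit_deg (cube_dir x j)) /\
  exists alpha, [/\ deg alpha = unit_deg (cube_dir x j), src alpha = rng y
                  & sval x = comp alpha y].
Proof.
rewrite /face /face_mor /=; have [s d1 d2 E] := factorP (deg_subKl (cube_dir_gt0 x j)).
split=> [->|[dy [b [db sb Eb]]]].
  by split=> //; exists (factor (deg_subKl (cube_dir_gt0 x j))).1.
by have [] := @factor_uniq _ _ b y _ _ sb s; rewrite ?dy ?db ?d1 ?d2 ?E ?Eb.
Qed.

Variable A : zmodType.

Definition cochain (r : nat) := cube r -> A.
HB.instance Definition _ r := GRing.Zmodule.on (cochain r).

(* [j] starts at 0 here, hence the sign [(-1)^(j + 1 + l)].                   *)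
Definition delta (r : nat) (f : cochain r) : cochain r.+1 :=
  fun x => \sum_(j < r.+1) \sum_(l : bool) f (face x j l) *~ (-1) ^+ (j.+1 + l)%N.

Lemma delta_is_zmod_morphism r : zmod_morphism (@delta r).
Proof.
move=> f g; apply/funext => x; rewrite /delta [RHS]/GRing.add /= [in RHS]/GRing.opp /=.
rewrite -sumrB; apply: eq_bigr => j _; rewrite -sumrB; apply: eq_bigr => l _.
by rewrite -mulrzBl.
Qed.
HB.instance Definition _ r :=
  GRing.isZmodMorphism.Build (cochain r) (cochain r.+1) (@delta r)
    (@delta_is_zmod_morphism r).

End Cubical.

Section Categorical.
Variables (k : nat) (L : kgraph k).

Record comptuple (r : nat) := CompTuple {
  ctval :> 'I_r -> mor L;
  ctvalP : forall i j : 'I_r, j = i.+1 :> nat -> src (ctval i) = rng (ctval j)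
}.

Lemma comptuple_eq r (t u : comptuple r) : (forall i, t i = u i) -> t = u.
Proof.
case: t u => t Pt [u Pu] /= /funext E; move: Pt Pu; rewrite E => Pt Pu.
by rewrite (Prop_irrelevance Pt Pu).
Qed.

(* The three kinds of terms of the coboundary at once: [cface_fun j] turns    *)
(* [(t_0, ..., t_r)] into [(t_1, ..., t_r)] if [j = 0], into                  *)
(* [(t_0, ..., t_(r-1))] if [j = r + 1], and otherwise replaces the entries   *)
(* [t_(j-1), t_j] by their composite.                                         *)
Definition cface_fun r (j : nat) (t : 'I_r.+1 -> mor L) : 'I_r -> mor L :=
  fun i => if (i.+1 < j)%N then t (widen_ord (leqnSn r) i)
           else if i.+1 == j then
             comp (t (widen_ord (leqnSn r) i)) (t (lift ord0 i))
           else t (lift ord0 i).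

Lemma cface_composable r (j : nat) (t : comptuple r.+1) (a b : 'I_r) :
  b = a.+1 :> nat -> src (cface_fun j t a) = rng (cface_fun j t b).
Proof.
move=> ba; rewrite /cface_fun ba.
have T (x y : 'I_r.+1) : y = x.+1 :> nat -> src (t x) = rng (t y) by exact: ctvalP.
case: (ltngtP a.+1 j) => aj; case: (ltngtP a.+2 j) => bj; try lia.
- by apply: T => /=; rewrite ba.
- rewrite rng_comp; first by apply: T => /=; rewrite ba.
  by apply: T; rewrite lift0.
- by apply: T; rewrite !lift0 ba.
- rewrite src_comp; first by apply: T; rewrite !lift0 ba.
  by apply: T; rewrite lift0.
Qed.

Definition cface r (j : nat) (t : comptuple r.+1) : comptuple r :=
  CompTuple (@cface_composable r j t).

Variable A : zmodType.

Definition normalized (r : nat) : {pred comptuple r -> A} :=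
  [pred f | `[< forall t : comptuple r, (exists i, deg (t i) = 0) -> f t = 0 >]].

Lemma normalizedP r (f : comptuple r -> A) :
  reflect (forall t : comptuple r, (exists i, deg (t i) = 0) -> f t = 0)
          (f \in @normalized r).
Proof. exact: asboolP. Qed.

Lemma normalized_zmod_closed r : zmod_closed (@normalized r).
Proof.
split=> [|f g /normalizedP Hf /normalizedP Hg]; apply/normalizedP => // t Ht.
by rewrite [LHS]/GRing.add /= Hf // add0r [LHS]/GRing.opp /= Hg // oppr0.
Qed.
HB.instance Definition _ r :=
  GRing.isZmodClosed.Build (comptuple r -> A) (@normalized r)
    (normalized_zmod_closed r).

Definition ccochain (r : nat) : Type := {f : comptuple r -> A | f \in @normalized r}.
HB.instance Definition _ r := [isSub of ccochain r for @sval _ _].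
HB.instance Definition _ r := [Choice of ccochain r by <:].
HB.instance Definition _ r := [SubChoice_isSubZmodule of ccochain r by <:].

Definition cdelta_fun (r : nat) (f : comptuple r -> A) (t : comptuple r.+1) : A :=
  \sum_(j < r.+2) f (cface j t) *~ (-1) ^+ j.

Lemma cdelta_normalized r (f : comptuple r -> A) :
  f \in @normalized r -> cdelta_fun f \in @normalized r.+1.
Proof.
move=> /normalizedP Hf; apply/normalizedP => t [m tm0].
have T (x y : 'I_r.+1) : y = x.+1 :> nat -> src (t x) = rng (t y) by exact: ctvalP.
rewrite /cdelta_fun (bigD1 (widen_ord (leqnSn _) m)) //=.
rewrite (bigD1 (lift ord0 m)) /=; last by rewrite -val_eqE /= /bump /=; lia.
rewrite [X in _ + (_ + X)]big1 ?addr0 => [|j /andP[]]; last first.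
  rewrite -!val_eqE /= /bump /= add1n => jm jm1.
  suff -> : f (cface j t) = 0 by rewrite mul0rz.
  apply: Hf; case: (ltnP j m) => jltm.
    have ir : (m.-1 < r)%N by have := ltn_ord m; lia.
    exists (Ordinal ir); rewrite /= /cface_fun /=.
    have -> : (m.-1.+1 < j)%N = false by lia.
    have -> : (m.-1.+1 == j) = false by lia.
    by rewrite (_ : lift ord0 _ = m) //; apply: val_inj; rewrite /= /bump /=; lia.
  have ir : (m < r)%N by have := ltn_ord j; lia.
  exists (Ordinal ir); rewrite /= /cface_fun /=.
  have -> : (m.+1 < j)%N by lia.
  by rewrite (_ : widen_ord _ _ = m) //; apply: val_inj.
rewrite /= /bump /= add1n exprS mulN1r mulrNz.
suff -> : cface m t = cface m.+1 t by rewrite subrr.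
apply: comptuple_eq => i; rewrite /= /cface_fun.
have Tl : src (t (widen_ord (leqnSn r) i)) = rng (t (lift ord0 i)).
  by apply: T; rewrite lift0.
case: (ltngtP i.+1 m) => im.
- by rewrite ifT //; lia.
- rewrite ifF; last by lia.
  case: eqP => // -[im']; rewrite comp_deg0l //.
  by rewrite (_ : widen_ord _ _ = m) //; apply: val_inj.
- rewrite ifT; last by lia.
  rewrite comp_deg0r //.
  by rewrite (_ : lift _ _ = m) //; apply: val_inj; rewrite /= /bump /=; lia.
Qed.

Definition cdelta (r : nat) (f : ccochain r) : ccochain r.+1 :=
  exist _ (cdelta_fun (sval f)) (cdelta_normalized (svalP f)).

Lemma cdelta_is_zmod_morphism r : zmod_morphism (@cdelta r).
Proof.
move=> f g; apply: val_inj; rewrite [RHS]raddfB.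
rewrite -[LHS]/(cdelta_fun (val (f - g))) raddfB; apply/funext => t.
rewrite /cdelta_fun [RHS]/GRing.add /= [in RHS]/GRing.opp /= -sumrB.
by apply: eq_bigr => j _; rewrite -mulrzBl.
Qed.
HB.instance Definition _ r :=
  GRing.isZmodMorphism.Build (ccochain r) (ccochain r.+1) (@cdelta r)
    (@cdelta_is_zmod_morphism r).

End Categorical.

Section Cohomology.
Variables (U V W : zmodType) (d1 : {additive U -> V}) (d2 : {additive V -> W}).

Definition is_cocycle : {pred V} := [pred v | d2 v == 0].

Lemma is_cocycle_zmod_closed : zmod_closed is_cocycle.
Proof.
split=> [|x y]; rewrite !inE ?raddf0 // => /eqP x0 /eqP y0.
by rewrite raddfB x0 y0 subr0.
Qed.
HB.instance Definition _ := GRing.isZmodClosed.Build V is_cocycle is_cocycle_zmod_closed.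

Definition cocycle : Type := {v : V | v \in is_cocycle}.
HB.instance Definition _ := [isSub of cocycle for @sval _ _].
HB.instance Definition _ := [Choice of cocycle by <:].
HB.instance Definition _ := [SubChoice_isSubZmodule of cocycle by <:].

(* In both complexes [d2 \o d1 = 0], so that this is the image of [d1], seen  *)
(* inside the subgroup of cocycles.                                           *)
Definition is_coboundary : {pred cocycle} := [pred z | `[< exists u, sval z = d1 u >]].

Lemma is_coboundaryP z : reflect (exists u, sval z = d1 u) (z \in is_coboundary).
Proof. exact: asboolP. Qed.

Lemma is_coboundary_zmod_closed : zmod_closed is_coboundary.
Proof.
split=> [|x y /is_coboundaryP[u xu] /is_coboundaryP[v yv]]; apply/is_coboundaryP.
  by exists 0; rewrite raddf0.
by exists (u - v); rewrite raddfB -xu -yv; exact: (raddfB val x y).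
Qed.
HB.instance Definition _ :=
  GRing.isZmodClosed.Build cocycle is_coboundary is_coboundary_zmod_closed.

Definition cohomology := Quotient.quot is_coboundary.
HB.instance Definition _ := GRing.Zmodule.on cohomology.

Definition cohomology_class (z : cocycle) : cohomology := \pi_cohomology z.

End Cohomology.

Section PathCategory.
Variables (k : nat) (L : kgraph k).

Definition edge : Type := cube L 1.

Definition edge_mor (e : edge) : mor L := sval e.

Definition color (e : edge) : 'I_k := cube_dir e ord0.

Fixpoint is_path (v : obj L) (s : seq edge) : Prop :=
  if s is e :: s' then rng (edge_mor e) = v /\ is_path (src (edge_mor e)) s'
  else True.

(* The string [u_1 ... u_n] is stored with its range, so that the vertices    *)
(* are the empty strings.                                                     *)
Record epath := EPath {
  epath_rng : obj L;
  epath_edges :> seq edge;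
  epathP : is_path epath_rng epath_edges
}.

Fixpoint path_mor (v : obj L) (s : seq edge) : mor L :=
  if s is e :: s' then comp (edge_mor e) (path_mor (src (edge_mor e)) s')
  else idm L v.

Definition epi (u : epath) : mor L := path_mor (epath_rng u) u.

Lemma rng_path_mor v s : is_path v s -> rng (path_mor v s) = v.
Proof.
elim: s v => [|e s IH] v /=; first by rewrite rng_idm.
by case=> <- /IH E; rewrite rng_comp.
Qed.

Lemma src_path_mor_cat v s1 s2 : is_path v s1 ->
  is_path (src (path_mor v s1)) s2 -> is_path v (s1 ++ s2).
Proof.
elim: s1 v => [|e s IH] v /=; first by rewrite src_idm.
by case=> <- Hs; rewrite src_comp ?rng_path_mor // => /(IH _ Hs).
Qed.

Lemma epath_cat_subproof (u v : epath) :
  src (epi u) = rng (epi v) -> is_path (epath_rng u) (epath_edges u ++ epath_edges v).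
Proof.
move=> uv; apply: src_path_mor_cat (epathP u) _.
by rewrite -/(epi u) uv rng_path_mor; exact: epathP.
Qed.

Definition epath_cat (u v : epath) (uv : src (epi u) = rng (epi v)) : epath :=
  EPath (epath_cat_subproof uv).

Definition nondecreasing (s : seq edge) : bool :=
  sorted (fun e f => (color e <= color f)%N) s.

Lemma epath_eq (u v : epath) :
  epath_rng u = epath_rng v -> epath_edges u = epath_edges v -> u = v.
Proof.
case: u v => a s P [b t Q] /= E1 E2; move: P Q; rewrite E1 E2 => P Q.
by rewrite (Prop_irrelevance P Q).
Qed.

Lemma deg_edge (e : edge) : deg (edge_mor e) = unit_deg (color e).
Proof.
have := cube_dirP e ord0; rewrite -/(color e) -/(edge_mor e) => e1.
case/andP: (svalP e) => _; rewrite -/(edge_mor e) /total_deg (bigD1 (color e)) //= e1.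
rewrite add1n eqSS sum_nat_eq0 => /forallP H.
apply/ffunP => i; rewrite ffunE; case: eqP => [<-//|/eqP ne] /=.
by apply/eqP; have := implyP (H i); apply; rewrite eq_sym.
Qed.

Lemma deg_path_mor v s (i : 'I_k) : is_path v s ->
  deg (path_mor v s) i = count (fun e => color e == i) s.
Proof.
elim: s v => [|e s IH] v /=; first by rewrite deg_idm ffunE.
case=> _ Hs; rewrite deg_comp ?rng_path_mor // ffunE -(IH _ Hs) deg_edge ffunE.
by [].
Qed.

Lemma edge_of_deg (l : mor L) i : deg l = unit_deg i -> is_cube 1 l.
Proof.
move=> E; apply/andP; split.
  by apply/forallP => j; rewrite E ffunE leq_b1.
rewrite /total_deg (bigD1 i) //= big1 ?E ?ffunE ?eqxx // => j ji.
by rewrite ffunE eq_sym (negbTE ji).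
Qed.

Lemma bar_exists (l : mor L) :
  exists u : epath, epi u = l /\ nondecreasing u.
Proof.
have [n] := ubnP (total_deg l); elim: n l => // n IH l; rewrite ltnS => ln.
have [/existsP[i0 Hi0]|] := boolP [exists i, 0 < deg l i]%N; last first.
  rewrite negb_exists => /forallP H.
  exists (@EPath (rng l) [::] I); split => //=; rewrite /epi /= -deg0_idm //.
  by apply/ffunP => i; apply/eqP; rewrite ffunE; have := H i; rewrite lt0n negbK.
have [i Hi imin] :=
  @arg_minnP _ i0 (fun i => 0 < deg l i)%N (fun i : 'I_k => i : nat) Hi0.
have [s d1 d2 E] := factorP (deg_subKl Hi).
set e0 := (factor _).1 in s d1 E; set l' := (factor _).2 in s d2 E.
have [|u [uE us]] := IH l'; first by rewrite -ltnS -(total_deg_sub Hi d2).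
pose e : edge := exist _ e0 (edge_of_deg d1).
have ce : color e = i.
  have := deg_edge e; rewrite [deg _]d1 => /ffunP /(_ i); rewrite !ffunE eqxx.
  by case: eqP.
have su : src e0 = epath_rng u.
  by rewrite s -uE /epi rng_path_mor //; exact: epathP.
have Pe : is_path (rng l) (e :: u).
  by split; [rewrite -E rng_comp|rewrite [src _]su; exact: epathP].
exists (EPath Pe); split.
  by rewrite -[LHS]/(comp e0 (path_mor (src e0) u)) su -/(epi u) uE.
have dE f := deg_path_mor (color f) (epathP u); rewrite /nondecreasing /=.
move: us dE; rewrite -/(epi u) uE d2 /nondecreasing.
case: (epath_edges u) => //= f t -> /(_ f); rewrite eqxx !ffunE andbT ce => dE.
by apply: imin; apply: leq_trans (leq_subr (unit_deg i (color f)) _); rewrite ffunE dE.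
Qed.

Lemma nondecreasing_le (e f : edge) (s : seq edge) :
  nondecreasing (e :: s) -> has (fun g => color g == color f) (e :: s) ->
  (color e <= color f)%N.
Proof.
move=> es /=; case/orP => [/eqP -> //|].
have tr : transitive (fun e f : edge => (color e <= color f)%N).
  by move=> x y z; exact: leq_trans.
have := order_path_min tr es.
by elim: s {es} => //= g s IH /andP[eg Hs] /orP[/eqP <-//|]; exact: IH.
Qed.

Lemma nondecreasing_uniq v w s t : is_path v s -> is_path w t ->
  nondecreasing s -> nondecreasing t -> path_mor v s = path_mor w t -> s = t.
Proof.
elim: s t v w => [|e s IH] [|f t] v w Ps Pt ss st E //.
- have := deg_path_mor (color f) Pt; rewrite -E /= deg_idm ffunE eqxx.
  by [].
- have := deg_path_mor (color e) Ps; rewrite E /= deg_idm ffunE eqxx.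
  by [].
have efE : color e = color f.
  apply/val_inj/eqP; rewrite eqn_leq; apply/andP; split.
    apply: (nondecreasing_le ss); rewrite has_count -(deg_path_mor _ Ps) E.
    by rewrite (deg_path_mor _ Pt) /= eqxx.
  apply: (nondecreasing_le st); rewrite has_count -(deg_path_mor _ Pt) -E.
  by rewrite (deg_path_mor _ Ps) /= eqxx.
have [_ Ps'] := Ps; have [_ Pt'] := Pt.
have re := esym (rng_path_mor Ps'); have rf := esym (rng_path_mor Pt').
have dE : deg (edge_mor e) = deg (edge_mor f) by rewrite !deg_edge efE.
have /= E' := E.
have dE' : deg (path_mor (src (edge_mor e)) s) = deg (path_mor (src (edge_mor f)) t).
  have := congr1 (@deg _ L) E'; rewrite !deg_comp // dE => /ffunP D.
  by apply/ffunP => i; have := D i; rewrite !ffunE => /addnI.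
have [ef st'] := factor_uniq re rf dE dE' E'.
congr cons; first exact: val_inj.
exact: (IH _ _ _ Ps' Pt' (path_sorted ss) (path_sorted st) st').
Qed.

Lemma bar_unique_exists (l : mor L) :
  exists! u : epath, epi u = l /\ nondecreasing u.
Proof.
have [u [ul us]] := bar_exists l; exists u; split=> // w [wl ws].
have E : epi u = epi w by rewrite ul wl.
apply: epath_eq; last exact: nondecreasing_uniq (epathP u) (epathP w) us ws E.
by rewrite -(rng_path_mor (epathP u)) -(rng_path_mor (epathP w)) -!/(epi _) E.
Qed.

Definition bar (l : mor L) : epath := projT1 (cid (bar_unique_exists l)).

Lemma barP (l : mor L) : epi (bar l) = l /\ nondecreasing (bar l).
Proof. by have [H _] := projT2 (cid (bar_unique_exists l)). Qed.

(* [(u, w)] is an allowable transition at a position [i = size p], and [x] is *)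
(* the morphism [pi (u_i u_(i+1))] at which [phi] is evaluated. It always is a *)
(* 2-cube because the colours of its two edges differ, and it is determined   *)
(* by [(u, w)], since [u] and [w] differ exactly at [i] and [i + 1].          *)
Definition allowable (u w : epath) (x : cube L 2) : Prop :=
  epi u = epi w /\
  exists (p q : seq edge) (a b a' b' : edge),
    [/\ epath_edges u = p ++ [:: a, b & q],
        epath_edges w = p ++ [:: a', b' & q],
        [/\ color b' = color a, (color a < color b)%N & color b = color a']
      & sval x = comp (edge_mor a) (edge_mor b)].

Variable A : zmodType.

(* [transition_sum phi w z a]: there are [w = w^0, w^1, ..., w^n = z] with    *)
(* every [(w^j, w^(j-1))] an allowable transition, and [a] is the sum of the  *)
(* corresponding values of [phi].                                             *)
Inductive transition_sum (phi : cochain L A 2) (w : epath) : epath -> A -> Prop :=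
| transition_sum0 : transition_sum phi w w 0
| transition_sumS u z x a :
    transition_sum phi w u a -> allowable z u x ->
    transition_sum phi w z (a + phi x).

(* The sum does not depend on the chosen sequence; [xget] picks its value.    *)
Definition S_phi (phi : cochain L A 2) (w : epath) : A :=
  xget 0 [set a | transition_sum phi w (bar (epi w)) a].

Lemma comptuple_bar (t : comptuple L 2) :
  src (epi (bar (t ord0))) = rng (epi (bar (t ord_max))).
Proof. by rewrite !(barP _).1; exact: ctvalP. Qed.

Definition c_phi (phi : cochain L A 2) (t : comptuple L 2) : A :=
  S_phi phi (epath_cat (comptuple_bar t)).

End PathCategory.

Section SecondCohomology.
Variables (k : nat) (L : kgraph k) (A : zmodType).

Definition Z2 : zmodType := cocycle (@delta k L A 2).
Definition H2 : zmodType := cohomology (@delta k L A 1) (@delta k L A 2).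
Definition cZ2 : zmodType := cocycle (@cdelta k L A 2).
Definition cH2 : zmodType := cohomology (@cdelta k L A 1) (@cdelta k L A 2).

Definition H2_class (phi : Z2) : H2 := cohomology_class _ phi.
Definition cH2_class (c : cZ2) : cH2 := cohomology_class _ c.

Definition Z2_val (phi : Z2) : cochain L A 2 := sval phi.
Definition cZ2_val (c : cZ2) : comptuple L 2 -> A := sval (sval c).

End SecondCohomology.

(* Main.v *)
From HB Require Import structures.
From mathcomp Require Import all_boot all_order all_algebra.
From mathcomp Require Import boolp classical_sets functions.
From mathcomp Require Import zify.
Require Import Defs.

(** Sorting the edges of a string by colour is a rewriting system: a step
    replaces a descending pair [a' b'] of consecutive edges by the ascending
    pair [a b] with the same composite, and is weighted by the value of the
    cubical cochain [phi] at that composite.  The proof rests on two remarks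
    about the total weight of a sorting.

    First, for a cubical cocycle the weight depends only on the string.  Two
    steps at disjoint places commute; two overlapping steps sort a string of
    three descending edges, whose composite is a 3-cube, in the two possible
    ways, and the difference of the two weights is [delta phi] at this 3-cube
    ([hexagon]).  Since sorting terminates, local confluence yields uniqueness
    ([weight_unique]).  So [c_phi] can be computed along any sorting.  Sorting
    [bar l ++ bar m ++ bar n] by bracketing it in the two ways gives the
    categorical cocycle identity ([c_phi_cocycle]), and additivity in [phi] is
    clear because a sorting does not involve [phi].

    Second, if there is a function [T] on strings such that each step from [s]
    to [t] has weight [T s - T t], then every sorting from [s] to [t] has weight
    [T s - T t] ([weight_potential]), hence [c_phi] at [(m, n)] is
    [T (bar m ++ bar n) - T (bar (m n))].  This is used with two potentials.

    - If [phi = delta f], the potential is minus the sum of [f] over the edges;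
      it is additive under concatenation, so [c_phi] is the coboundary of
      [T \o bar], and [psi] is well defined ([c_map_coboundary]).

    - Let [c] be a categorical cocycle, and let [T] send [u_1 ... u_n] to the
      sum of the [c (u_i, u_(i+1) ... u_n)].  By the cocycle identity
      [T (s t) = T s + T t + c (pi s, pi t)], so that a step from [a' b'] to
      [a b] changes [T] by [phi = c (a', b') - c (a, b)] evaluated at the square
      [a b = a' b'].  Having a potential, [phi] has equal weights on the two
      sides of every hexagon, so that it is a cubical cocycle; and the formula
      for [c_phi] reads [c_phi = c] plus the coboundary of [T \o bar].  Thus
      [psi] is surjective ([c_map_surj]).

    For injectivity, [bar a' ++ bar b'] is sorted by a single step and
    [bar a ++ bar b] is already sorted, whence
    [phi = c_phi (a', b') - c_phi (a, b)] on each square ([c_phi_square]).  If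
    [c_phi] is the coboundary of [g], the value of [g] at the common composite
    cancels and [phi] is the cubical coboundary of [- g] restricted to the edges
    ([c_map_coboundary_inv]). *)

Set Implicit Arguments.
Unset Strict Implicit.
Unset Printing Implicit Defensive.

Import GRing.Theory.
Local Open Scope ring_scope.
Local Open Scope quotient_scope.

(** * Squares and the faces of a cube *)

Section Squares.
Variables (k : nat) (L : kgraph k).
Implicit Types (a b e f : edge L) (l m n : mor L).

Lemma unit_deg_inj : injective (@unit_deg k).
Proof. by move=> i j /ffunP /(_ j); rewrite !ffunE eqxx; case: eqP. Qed.

Lemma edge_of_unit_deg l i : deg l = unit_deg i ->
  exists e : edge L, edge_mor e = l /\ color e = i.
Proof.
move=> dl; exists (exist _ l (edge_of_deg dl)); split=> //.
by apply: unit_deg_inj; rewrite -deg_edge.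
Qed.

Lemma deg_sub_addr (m n : {ffun 'I_k -> nat}) : deg_sub (m + n) n = m.
Proof. by apply/ffunP => i; rewrite !ffunE; exact: addnK. Qed.

(** [cube_dir] enumerates the directions of a cube, so that this determines
    it as soon as the set of directions is known. *)
Lemma cube_dir_mono r (x : cube L r) (i j : 'I_r) :
  (i < j)%N -> (cube_dir x i < cube_dir x j)%N.
Proof.
move=> ij; rewrite /cube_dir /enum_val.
set s := enum (cube_dirs x).
have ss : sorted ltn (map val s).
  rewrite /s /enum_mem -enumT sorted_map.
  apply: sorted_filter; first by move=> ? ? ?; exact: ltn_trans.
  by rewrite -sorted_map val_enum_ord iota_ltn_sorted.
have sz : size s = r by rewrite -(card_cube_dirs x) cardE.
set i' := cast_ord _ i; set j' := cast_ord _ j.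
rewrite (set_nth_default (enum_default i') (enum_default j')) -?cardE //.
have /= := sorted_ltn_nth ltn_trans (val (enum_default i')) ss.
move=> /(_ (val i) (val j)); rewrite !inE size_map sz !ltn_ord.
by move=> /(_ isT isT ij); rewrite !(nth_map (enum_default i')) ?sz ?ltn_ord //.
Qed.

Lemma face0_eq r (x : cube L r.+1) (j : 'I_r.+1) (y : cube L r) (f : edge L) :
  sval x = comp (sval y) (edge_mor f) -> src (sval y) = rng (edge_mor f) ->
  color f = cube_dir x j -> face x j false = y.
Proof.
move=> xE yf fj; apply: val_inj; apply: esym; apply/face0P.
split; last by exists (edge_mor f); split; rewrite // deg_edge fj.
by rewrite xE deg_comp // deg_edge fj deg_sub_addr.
Qed.

Lemma face1_eq r (x : cube L r.+1) (j : 'I_r.+1) (y : cube L r) (f : edge L) :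
  sval x = comp (edge_mor f) (sval y) -> src (edge_mor f) = rng (sval y) ->
  color f = cube_dir x j -> face x j true = y.
Proof.
move=> xE fy fj; apply: val_inj; apply: esym; apply/face1P.
split; last by exists (edge_mor f); split; rewrite // deg_edge fj.
by rewrite xE deg_comp // deg_edge fj addrC deg_sub_addr.
Qed.

Lemma total_deg_comp m n : src m = rng n ->
  total_deg (comp m n) = (total_deg m + total_deg n)%N.
Proof.
move=> mn; rewrite /total_deg -big_split /=.
by apply: eq_bigr => i _; rewrite deg_comp // ffunE.
Qed.

Lemma total_deg_edge e : total_deg (edge_mor e) = 1%N.
Proof. by case/andP: (svalP e) => _ /eqP. Qed.

(** The two factorisations of a 2-cube into edges; sorting by colour replaces
    [a' b'], whose colours descend, by [a b], whose colours ascend. *)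
Record square (a b a' b' : edge L) (x : cube L 2) : Prop := Square {
  sq_comp : src (edge_mor a) = rng (edge_mor b);
  sq_comp' : src (edge_mor a') = rng (edge_mor b');
  sq_first : color b' = color a;
  sq_second : color a' = color b;
  sq_lt : (color a < color b)%N;
  sq_mor : sval x = comp (edge_mor a) (edge_mor b);
  sq_mor' : sval x = comp (edge_mor a') (edge_mor b')
}.

Lemma edge_pair_cube a b : src (edge_mor a) = rng (edge_mor b) -> color a != color b ->
  exists x : cube L 2, sval x = comp (edge_mor a) (edge_mor b).
Proof.
move=> ab cab.
suff H : is_cube 2 (comp (edge_mor a) (edge_mor b)).
  by exists (exist (fun l => is_true (is_cube 2 l)) _ H).
rewrite /is_cube total_deg_comp // !total_deg_edge eqxx andbT.
apply/forallP => i; rewrite deg_comp // !deg_edge !ffunE.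
case: eqP => [<-|_] /=; last by case: eqP.
by rewrite eq_sym (negbTE cab).
Qed.

(** The factorisation property for the two orders of a sum of two generators. *)
Lemma edge_pair_swap a' b' : src (edge_mor a') = rng (edge_mor b') ->
  exists a b, [/\ src (edge_mor a) = rng (edge_mor b), color a = color b',
    color b = color a' & comp (edge_mor a) (edge_mor b) = comp (edge_mor a') (edge_mor b')].
Proof.
move=> ab'.
have dE : deg (comp (edge_mor a') (edge_mor b')) =
          unit_deg (color b') + unit_deg (color a').
  by rewrite deg_comp // !deg_edge addrC.
have [s d1 d2 E] := factorP dE.
have [a [aE ca]] := edge_of_unit_deg d1.
have [b [bE cb]] := edge_of_unit_deg d2.
by exists a, b; rewrite aE bE.
Qed.

Lemma square_exists a' b' : src (edge_mor a') = rng (edge_mor b') ->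
  (color b' < color a')%N -> exists a b x, square a b a' b' x.
Proof.
move=> ab' lt; have [a [b [ab ca cb E]]] := edge_pair_swap ab'.
have [|x xE] := edge_pair_cube ab.
  by rewrite ca cb -val_eqE /= ltn_eqF.
by exists a, b, x; split=> //; rewrite ?ca ?cb // xE.
Qed.

Lemma square_uniq a b x a1 b1 x1 a' b' :
  square a b a' b' x -> square a1 b1 a' b' x1 -> [/\ a = a1, b = b1 & x = x1].
Proof.
move=> s s1.
have xx1 : x = x1 by apply: val_inj; rewrite /= (sq_mor' s) (sq_mor' s1).
have := sq_mor s; rewrite xx1 (sq_mor s1) => E.
have [||a1a b1b] := factor_uniq (sq_comp s1) (sq_comp s) _ _ E.
- by rewrite !deg_edge -(sq_first s) -(sq_first s1).
- by rewrite !deg_edge -(sq_second s) -(sq_second s1).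
by split=> //; apply: val_inj.
Qed.

Lemma cube2_square (x : cube L 2) : exists a b a' b', square a b a' b' x.
Proof.
have lt01 := cube_dir_mono x (isT : (@ord0 1 < @ord_max 1)%N).
have dx : deg (sval x) = unit_deg (cube_dir x ord0) + unit_deg (cube_dir x ord_max).
  case/andP: (svalP x) => /forallP x1 /eqP.
  rewrite /total_deg (bigD1 (cube_dir x ord0)) //= (bigD1 (cube_dir x ord_max)) /=; last first.
    by rewrite -val_eqE /= gtn_eqF.
  rewrite !cube_dirP => -[] /eqP; rewrite sum_nat_eq0 => /forallP H.
  apply/ffunP => i; rewrite !ffunE; have := implyP (H i).
  case: (eqVneq i (cube_dir x ord0)) => [->|n0].
    by rewrite cube_dirP (negbTE (_ : cube_dir x ord_max != _)) // -val_eqE /= gtn_eqF.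
  case: (eqVneq i (cube_dir x ord_max)) => [->|n1] /=; first by rewrite cube_dirP.
  by move=> /(_ isT) /eqP.
have [s d1 d2 E] := factorP dx.
have [a [aE ca]] := edge_of_unit_deg d1.
have [b [bE cb]] := edge_of_unit_deg d2.
have ab : src (edge_mor a) = rng (edge_mor b) by rewrite aE bE.
have [a' [b' [ab' ca' cb' E']]] := edge_pair_swap ab.
exists a, b, a', b'; split=> //; first by rewrite ca cb.
  by rewrite aE bE.
by rewrite E' aE bE.
Qed.

Lemma incr2_eq (d0 d1 i j : 'I_k) : (d0 < d1)%N -> (i < j)%N ->
  (d0 == i) || (d0 == j) -> (d1 == i) || (d1 == j) -> d0 = i /\ d1 = j.
Proof. by rewrite -!val_eqE /= => *; split; apply: val_inj => /=; lia. Qed.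

Lemma incr3_eq (d0 d1 d2 i j h : 'I_k) : (d0 < d1)%N -> (d1 < d2)%N ->
  (i < j)%N -> (j < h)%N ->
  [|| d0 == i, d0 == j | d0 == h] -> [|| d1 == i, d1 == j | d1 == h] ->
  [|| d2 == i, d2 == j | d2 == h] -> [/\ d0 = i, d1 = j & d2 = h].
Proof. by rewrite -!val_eqE /= => *; split; apply: val_inj => /=; lia. Qed.

Variable A : zmodType.

Lemma square_dirs a b a' b' x : square a b a' b' x ->
  cube_dir x ord0 = color a /\ cube_dir x ord_max = color b.
Proof.
move=> s; apply: incr2_eq; rewrite ?cube_dir_mono ?(sq_lt s) //.
- have := cube_dirP x ord0; rewrite (sq_mor s) deg_comp ?(sq_comp s) //.
  by rewrite !deg_edge !ffunE !(eq_sym (cube_dir x ord0)); do 2 case: eqP.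
- have := cube_dirP x ord_max; rewrite (sq_mor s) deg_comp ?(sq_comp s) //.
  by rewrite !deg_edge !ffunE !(eq_sym (cube_dir x ord_max)); do 2 case: eqP.
Qed.

Lemma square_faces a b a' b' x : square a b a' b' x ->
  [/\ face x ord0 false = a', face x ord0 true = b,
      face x ord_max false = a & face x ord_max true = b'].
Proof.
move=> s; have [d0 d1] := square_dirs s; split.
- by apply: (face0_eq (f := b')); rewrite ?d0 ?(sq_mor' s) ?(sq_first s) ?(sq_comp' s).
- by apply: (face1_eq (f := a)); rewrite ?d0 ?(sq_mor s) ?(sq_comp s).
- by apply: (face0_eq (f := b)); rewrite ?d1 ?(sq_mor s) ?(sq_comp s).
- by apply: (face1_eq (f := a')); rewrite ?d1 ?(sq_mor' s) ?(sq_second s) ?(sq_comp' s).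
Qed.

(** Along a sorting step, the right-hand side is the variation of the sum of
    [f] over the edges of the string: coboundaries have a potential. *)
Lemma delta1_square (f : cochain L A 1) a b a' b' x : square a b a' b' x ->
  delta f x = (f a + f b) - (f a' + f b').
Proof.
move=> s; have [F00 F01 F10 F11] := square_faces s.
rewrite /delta !big_ord_recl big_ord0 addr0 !big_bool /=.
rewrite (_ : lift ord0 ord0 = ord_max); last exact: val_inj.
rewrite F00 F01 F10 F11 /= /bump /= expr1 !exprS expr0 !mulr1 !mulN1r !opprK.
by rewrite !mulrNz !mulr1z opprD !addrA [LHS](ACl (4*1*2*3)).
Qed.

Lemma delta2_faces (phi : cochain L A 2) (x : cube L 3)
    (f00 f01 f10 f11 f20 f21 : cube L 2) :
  face x ord0 false = f00 -> face x ord0 true = f01 ->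
  face x (lift ord0 ord0) false = f10 -> face x (lift ord0 ord0) true = f11 ->
  face x ord_max false = f20 -> face x ord_max true = f21 ->
  delta phi x = (phi f21 + (phi f10 + phi f01)) - (phi f00 + (phi f11 + phi f20)).
Proof.
move=> F00 F01 F10 F11 F20 F21.
rewrite /delta !big_ord_recl big_ord0 addr0 !big_bool /=.
rewrite (_ : lift ord0 (lift ord0 ord0) = ord_max); last exact: val_inj.
rewrite F00 F01 F10 F11 F20 F21 /= /bump /= !exprS expr0 !mulr1 !mulN1r !opprK.
by rewrite !mulrNz !mulr1z !opprD !addrA [LHS](ACl (5*4*1*2*3*6)).
Qed.

End Squares.

(** * Sorting strings of edges *)

Section Sorting.
Variables (k : nat) (L : kgraph k).
Implicit Types (a b e f : edge L) (l m n : mor L) (s t u p q : seq (edge L)).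

Lemma is_path_cat v s t :
  is_path v (s ++ t) <-> is_path v s /\ is_path (src (path_mor v s)) t.
Proof.
elim: s v => [|e s IH] v /=; first by rewrite src_idm; tauto.
split=> [[<-] /IH[ps pt]|[[<- ps]]].
  by rewrite src_comp ?rng_path_mor.
by rewrite src_comp ?rng_path_mor // => pt; split=> //; apply/IH.
Qed.

Lemma path_mor_cat v s t : is_path v (s ++ t) ->
  path_mor v (s ++ t) = comp (path_mor v s) (path_mor (src (path_mor v s)) t).
Proof.
elim: s v => [|e s IH] v /=.
  by move=> pt; rewrite src_idm -[v in idm L v](rng_path_mor pt) comp_idl.
case=> _ pst; have /is_path_cat[ps pt] := pst.
by rewrite src_comp ?rng_path_mor // IH // comp_assoc ?rng_path_mor.
Qed.

Lemma path_mor2 v e f s : is_path v [:: e, f & s] ->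
  path_mor v [:: e, f & s] =
  comp (comp (edge_mor e) (edge_mor f)) (path_mor (src (edge_mor f)) s).
Proof. by case=> /= _ [ef ps]; rewrite comp_assoc ?rng_path_mor. Qed.

(** The reverse of an allowable transition.  It is stated on bare lists of
    edges so that steps can be put in context by concatenation alone;
    that the list is composable is carried separately by [is_path]. *)
Definition sort_step s t (x : cube L 2) : Prop :=
  exists p q a b a' b',
    [/\ s = p ++ [:: a', b' & q], t = p ++ [:: a, b & q] & square a b a' b' x].

(** Partial sortings are included: [t] may still have descents. The last
    argument records the 2-cubes crossed and not their weight, so
    that one sorting serves all cochains at once. *)
Inductive sorting : seq (edge L) -> seq (edge L) -> seq (cube L 2) -> Prop :=
| sorting_nil s : sorting s s [::]
| sorting_cons s u t x xs : sort_step s u x -> sorting u t xs -> sorting s t (x :: xs).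

Lemma sort_step_path v s t x : is_path v s -> sort_step s t x ->
  is_path v t /\ path_mor v t = path_mor v s.
Proof.
move=> ps [p [q [a [b [a' [b' [sE -> sq]]]]]]]; rewrite {}sE in ps *.
have /is_path_cat[pp pab'] := ps.
have E : comp (edge_mor a) (edge_mor b) = comp (edge_mor a') (edge_mor b').
  by rewrite -(sq_mor sq) (sq_mor' sq).
have src_b : src (edge_mor b) = src (edge_mor b').
  by rewrite -(src_comp (sq_comp sq)) E src_comp // (sq_comp' sq).
have pab : is_path (src (path_mor v p)) [:: a, b & q].
  case: pab' => ra' [_ pq] /=; rewrite -(sq_comp sq) src_b; split=> //.
  by rewrite -(rng_comp (sq_comp sq)) E rng_comp // (sq_comp' sq).
have pt : is_path v (p ++ [:: a, b & q]) by apply/is_path_cat.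
by rewrite !path_mor_cat // !path_mor2 // E src_b.
Qed.

Lemma sorting_path v s t xs : is_path v s -> sorting s t xs ->
  is_path v t /\ path_mor v t = path_mor v s.
Proof.
move=> + st; elim: st => // {}s u {}t x {}xs su _ IH ps.
by have [/IH[pt ->] ->] := sort_step_path ps su.
Qed.

Lemma sorting_trans s u t xs ys :
  sorting s u xs -> sorting u t ys -> sorting s t (xs ++ ys).
Proof. by elim=> // {}s v {}u x {}xs sv _ IH ut /=; exact: sorting_cons sv (IH ut). Qed.

Lemma sorting_catl p s t xs : sorting s t xs -> sorting (p ++ s) (p ++ t) xs.
Proof.
elim=> [{}s|{}s u {}t x {}xs su _ IH]; first exact: sorting_nil.
apply: sorting_cons IH; case: su => [p' [q [a [b [a' [b' [-> -> sq]]]]]]].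
by exists (p ++ p'), q, a, b, a', b'; rewrite -!catA.
Qed.

Lemma sorting_catr q s t xs : sorting s t xs -> sorting (s ++ q) (t ++ q) xs.
Proof.
elim=> [{}s|{}s u {}t x {}xs su _ IH]; first exact: sorting_nil.
apply: sorting_cons IH; case: su => [p [q' [a [b [a' [b' [-> -> sq]]]]]]].
by exists p, (q' ++ q), a, b, a', b'; rewrite -!catA.
Qed.

Lemma sorting_square p q a b a' b' x : square a b a' b' x ->
  sorting (p ++ [:: a', b' & q]) (p ++ [:: a, b & q]) [:: x].
Proof.
move=> sq; apply: sorting_cons (sorting_nil _).
by exists p, q, a, b, a', b'.
Qed.

Lemma sort_step_not_nondecreasing s t x : sort_step s t x -> ~~ nondecreasing s.
Proof.
move=> [p [q [a [b [a' [b' [-> _ sq]]]]]]]; apply/negP => /cat_sorted2[_] /=.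
by rewrite (sq_first sq) (sq_second sq) leqNgt (sq_lt sq).
Qed.

Lemma sorting_inv s t xs : sorting s t xs -> nondecreasing t ->
  (nondecreasing s /\ xs = [::]) \/
  exists u x ys, [/\ xs = x :: ys, sort_step s u x & sorting u t ys].
Proof.
case=> [{}s ss|{}s u {}t x {}xs su ut _]; first by left.
by right; exists u, x, xs.
Qed.

Lemma not_nondecreasing_step v s : is_path v s -> ~~ nondecreasing s ->
  exists t x, sort_step s t x.
Proof.
elim: s v => [|e [|f s] IH] v //= [_ pfs]; have [fe _] := pfs.
rewrite /nondecreasing /= negb_and -ltnNge => /orP[lt|ns].
  have [a [b [x sq]]] := square_exists (esym fe) lt.
  by exists [:: a, b & s], x, [::], s, a, b, e, f.
have [t [x [p [q [a [b [a' [b' [-> _ sq]]]]]]]]] := IH _ pfs ns.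
by exists (e :: p ++ [:: a, b & q]), x, (e :: p), q, a, b, a', b'.
Qed.

(** Each edge counts its colour as many times as there are edges after it, so
    that moving the larger colour to the right lowers the total. *)
Fixpoint disorder s : nat :=
  if s is e :: s' then (color e * size s' + disorder s')%N else 0%N.

Lemma sort_step_disorder s t x : sort_step s t x -> (disorder t < disorder s)%N.
Proof.
move=> [p [q [a [b [a' [b' [-> -> sq]]]]]]]; elim: p => [|e p IH] /=.
  rewrite (sq_first sq) (sq_second sq) !mulnS; have := sq_lt sq; lia.
by rewrite !size_cat ltn_add2l.
Qed.

Lemma sorting_exists v s : is_path v s -> exists t xs, sorting s t xs /\ nondecreasing t.
Proof.
have [n] := ubnP (disorder s); elim: n s => // n IH s sn ps.
have [ss|/(not_nondecreasing_step ps)[u [x su]]] := boolP (nondecreasing s).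
  by exists s, [::]; split=> //; exact: sorting_nil.
have [|t [xs [ut tt]]] := IH u _ (sort_step_path ps su).1.
  by have := sort_step_disorder su; lia.
by exists t, (x :: xs); split=> //; exact: sorting_cons su ut.
Qed.

Lemma cube3_exists e3 e2 e1 :
  src (edge_mor e3) = rng (edge_mor e2) -> src (edge_mor e2) = rng (edge_mor e1) ->
  (color e1 < color e2)%N -> (color e2 < color e3)%N ->
  exists x : cube L 3, sval x = comp (edge_mor e3) (comp (edge_mor e2) (edge_mor e1)).
Proof.
move=> c32 c21 lt12 lt23; set l := comp _ _.
have c3 : src (edge_mor e3) = rng (comp (edge_mor e2) (edge_mor e1)) by rewrite rng_comp.
suff H : is_cube 3 l by exists (exist (fun l => is_true (is_cube 3 l)) _ H).
rewrite /is_cube !total_deg_comp // !total_deg_edge eqxx andbT.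
apply/forallP => i; rewrite !deg_comp // !deg_edge !ffunE -!val_eqE /=; lia.
Qed.

Lemma cube3_dirs e3 e2 e1 (x : cube L 3) :
  src (edge_mor e3) = rng (edge_mor e2) -> src (edge_mor e2) = rng (edge_mor e1) ->
  (color e1 < color e2)%N -> (color e2 < color e3)%N ->
  sval x = comp (edge_mor e3) (comp (edge_mor e2) (edge_mor e1)) ->
  [/\ cube_dir x ord0 = color e1, cube_dir x (lift ord0 ord0) = color e2
    & cube_dir x ord_max = color e3].
Proof.
move=> c32 c21 lt12 lt23 xE.
have D j : [|| cube_dir x j == color e1, cube_dir x j == color e2
             | cube_dir x j == color e3].
  have := cube_dirP x j; rewrite xE !deg_comp ?rng_comp // !deg_edge !ffunE -!val_eqE /=; lia.
by apply: incr3_eq; rewrite ?cube_dir_mono ?D.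
Qed.

(** The factorisation of a 3-cube with descending colours, obtained by splitting
    off an edge in its last direction. *)
Lemma cube3_edges (x : cube L 3) : exists e3 e2 e1,
  [/\ src (edge_mor e3) = rng (edge_mor e2), src (edge_mor e2) = rng (edge_mor e1),
      (color e1 < color e2)%N, (color e2 < color e3)%N
    & sval x = comp (edge_mor e3) (comp (edge_mor e2) (edge_mor e1))].
Proof.
have [_ [l [dl ly xE]]] := (face1P x ord_max _).1 erefl.
have [e3 [e3E c3]] := edge_of_unit_deg dl.
have [a [b [e2 [e1 sq]]]] := cube2_square (face x ord_max true).
have c21 := sq_comp' sq; rewrite (sq_mor' sq) -e3E in ly xE.
have D j : [|| cube_dir x j == color e1, cube_dir x j == color e2
             | cube_dir x j == color e3].
  have := cube_dirP x j; rewrite xE !deg_comp // !deg_edge !ffunE -!val_eqE /=; lia.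
have lt12 : (color e1 < color e2)%N by rewrite (sq_first sq) (sq_second sq) (sq_lt sq).
exists e3, e2, e1; split=> //; first by rewrite -(rng_comp c21).
have := D ord0; have := D (lift ord0 ord0).
have := @cube_dir_mono _ _ _ x ord0 (lift ord0 ord0) isT.
have := @cube_dir_mono _ _ _ x (lift ord0 ord0) ord_max isT.
by rewrite -!val_eqE /= -c3; lia.
Qed.

(** The two ways of sorting a descending triple [e3 e2 e1] cross the six faces
    of the 3-cube [e3 e2 e1], three faces each: sorting [e3 e2] first crosses
    [F_1^0], [F_2^1] and [F_3^0], and sorting [e2 e1] first crosses [F_3^1],
    [F_2^0] and [F_1^1].  Both end at the same string, because sorted strings are
    determined by their composite. *)
Lemma hexagon e3 e2 e1 f2 f3 x1 k1 k2 y1 :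
  square f2 f3 e3 e2 x1 -> square k1 k2 e2 e1 y1 ->
  exists (t : seq (edge L)) (x2 x3 y2 y3 : cube L 2) (x : cube L 3),
    [/\ sorting [:: f2; f3; e1] t [:: x2; x3], sorting [:: e3; k1; k2] t [:: y2; y3],
        sval x = comp (edge_mor e3) (comp (edge_mor e2) (edge_mor e1))
      & forall (A : zmodType) (phi : cochain L A 2), delta phi x =
          (phi y1 + (phi y2 + phi y3)) - (phi x1 + (phi x2 + phi x3))].
Proof.
move=> sx1 sy1; have c32 := sq_comp' sx1; have c21 := sq_comp' sy1.
have lt12 : (color e1 < color e2)%N.
  by rewrite (sq_first sy1) (sq_second sy1) (sq_lt sy1).
have lt23 : (color e2 < color e3)%N.
  by rewrite (sq_first sx1) (sq_second sx1) (sq_lt sx1).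
have P0 : is_path (rng (edge_mor e3)) [:: e3; e2; e1] by [].
have SX1 : sorting [:: e3; e2; e1] [:: f2; f3; e1] [:: x1].
  exact: (sorting_square [::] [:: e1] sx1).
have SY1 : sorting [:: e3; e2; e1] [:: e3; k1; k2] [:: y1].
  exact: (sorting_square [:: e3] [::] sy1).
have [/= [_ [c_f2f3 [c_f3e1 _]]] _] := sorting_path P0 SX1.
have [/= [_ [c_e3k1 [c_k1k2 _]]] _] := sorting_path P0 SY1.
have [|g1 [g3 [x2 sx2]]] := square_exists (esym c_f3e1).
  by rewrite -(sq_second sx1) (ltn_trans lt12).
have [|l1 [l3 [y2 sy2]]] := square_exists (esym c_e3k1).
  by rewrite -(sq_first sy1) (ltn_trans lt12).
have SX2 := sorting_square [:: f2] [::] sx2.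
have SY2 := sorting_square [::] [:: k2] sy2.
have SX12 := sorting_trans SX1 SX2; have SY12 := sorting_trans SY1 SY2.
have [/= [_ [c_f2g1 [c_g1g3 _]]] _] := sorting_path P0 SX12.
have [/= [_ [c_l1l3 [c_l3k2 _]]] _] := sorting_path P0 SY12.
have [|h1 [h2 [x3 sx3]]] := square_exists (esym c_f2g1).
  by rewrite -(sq_first sx1) -(sq_first sx2).
have [|m2 [m3 [y3 sy3]]] := square_exists (esym c_l3k2).
  by rewrite -(sq_second sy1) -(sq_second sy2).
have SX3 := sorting_square [::] [:: g3] sx3.
have SY3 := sorting_square [:: l1] [::] sy3.
have SX := sorting_trans SX12 SX3; have SY := sorting_trans SY12 SY3.
have [PX EX] := sorting_path P0 SX; have [PY EY] := sorting_path P0 SY.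
(* Each edge keeps its colour along the steps, so both strings are sorted. *)
have tE : [:: h1; h2; g3] = [:: l1; m2; m3].
  apply: (nondecreasing_uniq PX PY); last exact: etrans EX (esym EY).
    rewrite /nondecreasing /= andbT -(sq_first sx3) -(sq_second sx3) -(sq_second sx2).
    by rewrite -(sq_second sx1) -(sq_first sx2) -(sq_first sx1) (ltnW lt12) (ltnW lt23).
  rewrite /nondecreasing /= andbT -(sq_first sy2) -(sq_first sy3) -(sq_second sy3).
  by rewrite -(sq_second sy2) -(sq_second sy1) -(sq_first sy1) (ltnW lt12) (ltnW lt23).
have [x xE] := cube3_exists c32 c21 lt12 lt23.
have [d0 d1 d2] := cube3_dirs c32 c21 lt12 lt23 xE.
exists [:: h1; h2; g3], x2, x3, y2, y3, x; split.
- exact: sorting_trans SX2 SX3.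
- by rewrite tE; exact: sorting_trans SY2 SY3.
- exact: xE.
move=> A phi; apply: delta2_faces.
- apply: (face0_eq (f := e1)); rewrite ?d0 ?(sq_mor' sx1) ?src_comp //.
  by rewrite xE comp_assoc.
- apply: (face1_eq (f := l1)); rewrite ?d0 -?(sq_first sy2) -?(sq_first sy1) //.
    rewrite (sq_mor' sy3) comp_assoc // -(sq_mor sy2) (sq_mor' sy2).
    by rewrite -comp_assoc // -(sq_mor sy1) (sq_mor' sy1).
  by rewrite (sq_mor' sy3) rng_comp.
- apply: (face0_eq (f := k2)); rewrite ?d1 -?(sq_second sy1) //.
    by rewrite (sq_mor' sy2) -comp_assoc // -(sq_mor sy1) (sq_mor' sy1).
  by rewrite (sq_mor' sy2) src_comp.
- apply: (face1_eq (f := f2)); rewrite ?d1 -?(sq_first sx1) //.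
    by rewrite (sq_mor' sx2) comp_assoc // -(sq_mor sx1) (sq_mor' sx1) -comp_assoc.
  by rewrite (sq_mor' sx2) rng_comp.
- apply: (face0_eq (f := g3)); rewrite ?d2 -?(sq_second sx2) -?(sq_second sx1) //.
    rewrite (sq_mor' sx3) -comp_assoc // -(sq_mor sx2) (sq_mor' sx2) comp_assoc //.
    by rewrite -(sq_mor sx1) (sq_mor' sx1) -comp_assoc.
  by rewrite (sq_mor' sx3) src_comp.
- by apply: (face1_eq (f := e3)); rewrite ?d2 ?(sq_mor' sy1) ?rng_comp.
Qed.

Section Confluence.
Variables (A : zmodType) (phi : cochain L A 2).
Hypothesis phi_cocycle : delta phi = 0.

Definition weight (xs : seq (cube L 2)) : A := \sum_(x <- xs) phi x.

Definition joinable s1 x1 s2 x2 : Prop := exists t xs1 xs2,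
  [/\ sorting s1 t xs1, sorting s2 t xs2 & weight (x1 :: xs1) = weight (x2 :: xs2)].

Lemma joinable_sym s1 x1 s2 x2 : joinable s1 x1 s2 x2 -> joinable s2 x2 s1 x1.
Proof. by move=> [t [xs1 [xs2 [st1 st2 E]]]]; exists t, xs2, xs1. Qed.

(** Two steps, the first of which acts at the head of the string: according
    to the length of [p] they act on the same pair, overlap in one edge or are
    disjoint.  An overlap is resolved by the hexagon, where [delta phi] has to
    vanish; disjoint steps commute. *)
Lemma joinable_head p q q' a b a' b' c d c' d' x y :
  [:: a', b' & q] = p ++ [:: c', d' & q'] ->
  square a b a' b' x -> square c d c' d' y ->
  joinable [:: a, b & q] x (p ++ [:: c, d & q']) y.
Proof.
case: p => [|e [|f p]] /= [].
- move=> -> -> -> sx sy; have [-> -> ->] := square_uniq sx sy.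
  by exists [:: c, d & q'], [::], [::]; split=> //; exact: sorting_nil.
- move=> <- <- -> sx sy.
  have [t [x2 [x3 [y2 [y3 [z [tx ty _ /(_ A phi)]]]]]]] := hexagon sx sy.
  rewrite phi_cocycle => /esym/eqP; rewrite subr_eq0 => /eqP E.
  exists (t ++ q'), [:: x2; x3], [:: y2; y3]; split.
  + exact: (sorting_catr q' tx).
  + exact: (sorting_catr q' ty).
  + by rewrite /weight !big_cons !big_nil !addr0 E.
- move=> <- <- -> sx sy.
  exists [:: a, b & p ++ [:: c, d & q']], [:: y], [:: x]; split.
  + exact: (sorting_square [:: a, b & p] q' sy).
  + exact: (sorting_square [::] (p ++ [:: c, d & q']) sx).
  + by rewrite /weight !big_cons !big_nil !addr0 addrC.
Qed.

Lemma local_confluence s s1 s2 x1 x2 :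
  sort_step s s1 x1 -> sort_step s s2 x2 -> joinable s1 x1 s2 x2.
Proof.
move=> [p [q [a [b [a' [b' [-> -> sx]]]]]]] [p' [q' [c [d [c' [d' [+ -> sy]]]]]]].
elim: p p' => [|e p IH] [|e' p'] E.
- exact: joinable_head E sx sy.
- exact: joinable_head E sx sy.
- exact/joinable_sym/(joinable_head (esym E) sy sx).
case: E => <- /IH[t [xs1 [xs2 [st1 st2 E]]]].
by exists (e :: t), xs1, xs2; split=> //; exact: (sorting_catl [:: e]).
Qed.

(** Newman's lemma with weights: local confluence and termination. *)
Lemma weight_unique v s t t' xs xs' : is_path v s ->
  sorting s t xs -> nondecreasing t -> sorting s t' xs' -> nondecreasing t' ->
  weight xs = weight xs'.
Proof.
have [n] := ubnP (disorder s); elim: n s t t' xs xs' => // n IH s t t' xs xs' sn ps.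
move=> /sorting_inv + tt /sorting_inv + tt' => /(_ tt) inv /(_ tt').
case: inv => [[ss ->] [[_ ->] //|[u [x [ys [_ /sort_step_not_nondecreasing]]]]]|].
  by rewrite ss.
move=> [u [x [{}xs [-> su ut]]]].
case=> [[ss _]|[u' [x' [{}xs' [-> su' ut']]]]].
  by have := sort_step_not_nondecreasing su; rewrite ss.
have [z [ys [ys' [uz uz' E]]]] := local_confluence su su'.
have pu := (sort_step_path ps su).1; have pu' := (sort_step_path ps su').1.
(* Sorting the bottom [z] of the diamond makes the induction hypothesis apply to
   both of its sides. *)
have [w [zs [zw ww]]] := sorting_exists (sorting_path pu uz).1.
have du := sort_step_disorder su; have du' := sort_step_disorder su'.
have E1 : weight xs = weight (ys ++ zs).
  by apply: (IH _ _ _ _ _ _ pu ut tt (sorting_trans uz zw) ww); lia.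
have E2 : weight xs' = weight (ys' ++ zs).
  by apply: (IH _ _ _ _ _ _ pu' ut' tt' (sorting_trans uz' zw) ww); lia.
move: E E1 E2; rewrite /weight !big_cons !big_cat /= => E -> ->.
by rewrite !addrA E.
Qed.

End Confluence.

End Sorting.

(** * Weights computed from a potential, and the value of [S_phi] *)

Section Potential.
Variables (k : nat) (L : kgraph k) (A : zmodType).
Implicit Types (e : edge L) (l m n : mor L) (s t p q : seq (edge L)).
Implicit Types (phi : cochain L A 2).

(** The weights telescope.  Two sortings with the same ends then have the same
    weight, which is how a cochain can be shown to be a cocycle. *)
Lemma weight_potential phi (T : seq (edge L) -> A) v s t xs :
  (forall v s t x, is_path v s -> sort_step s t x -> phi x = T s - T t) ->
  is_path v s -> sorting s t xs -> weight phi xs = T s - T t.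
Proof.
move=> HT + st; elim: st => [{}s _|{}s u {}t x {}xs su _ IH ps].
  by rewrite /weight big_nil subrr.
have [pu _] := sort_step_path ps su.
by rewrite /weight big_cons [X in _ + X](IH pu) (HT _ _ _ _ ps su) addrA subrK.
Qed.

Lemma weightD phi phi' xs : weight (phi + phi') xs = weight phi xs + weight phi' xs.
Proof. by rewrite /weight -big_split. Qed.

Lemma bar_path l : is_path (rng l) (bar l).
Proof. by rewrite -{1}(barP l).1 /epi rng_path_mor; exact: epathP. Qed.

Lemma epath_rng_bar l : epath_rng (bar l) = rng l.
Proof. by rewrite -[in RHS](barP l).1 /epi rng_path_mor //; exact: epathP. Qed.

Lemma path_mor_bar l : path_mor (rng l) (bar l) = l.
Proof. by rewrite -[RHS](barP l).1 /epi epath_rng_bar. Qed.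

Lemma bar_eq v s l : is_path v s -> path_mor v s = l -> nondecreasing s ->
  s = bar l.
Proof.
by move=> ps E ss; apply: (nondecreasing_uniq ps (bar_path l) ss (barP l).2);
   rewrite path_mor_bar.
Qed.

Lemma bar_cat_path m n : src m = rng n -> is_path (rng m) (bar m ++ bar n).
Proof.
by move=> mn; apply/is_path_cat; rewrite path_mor_bar mn; split; exact: bar_path.
Qed.

Lemma path_mor_bar_cat m n : src m = rng n ->
  path_mor (rng m) (bar m ++ bar n) = comp m n.
Proof.
by move=> mn; rewrite path_mor_cat ?path_mor_bar ?mn ?path_mor_bar //; exact: bar_cat_path.
Qed.

Lemma sorting_bar v s : is_path v s -> exists xs, sorting s (bar (path_mor v s)) xs.
Proof.
move=> ps; have [t [xs [st tt]]] := sorting_exists ps; exists xs.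
by have [pt tE] := sorting_path ps st; rewrite -(bar_eq pt tE tt).
Qed.

Lemma sorting_bar_cat m n : src m = rng n ->
  exists xs, sorting (bar m ++ bar n) (bar (comp m n)) xs.
Proof. by move=> mn; have := sorting_bar (bar_cat_path mn); rewrite path_mor_bar_cat. Qed.

(** An allowable transition only asks that the two whole strings have the same
    composite; unique factorisation cancels the common prefix and suffix, which
    leaves a square. *)
Lemma allowable_step (u w : epath L) x : allowable u w x -> sort_step w u x.
Proof.
move=> [E [p [q [a [b [a' [b' [uE wE [cb' lt cb] xE]]]]]]]].
exists p, q, a, b, a', b'; split=> //.
have rE : epath_rng u = epath_rng w.
  by rewrite -(rng_path_mor (epathP u)) -(rng_path_mor (epathP w)) -!/(epi _) E.
have pu := epathP u; have pw := epathP w; rewrite uE rE in pu; rewrite wE in pw.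
move: E; rewrite /epi uE wE rE !path_mor_cat //.
have /is_path_cat[pp pab] := pu; have /is_path_cat[_ pab'] := pw.
have [ra [ab pq]] := pab; have [ra' [ab' pq']] := pab'.
move=> /factor_uniq[]; rewrite ?rng_path_mor //.
  apply/ffunP => i; rewrite !(deg_path_mor _ pab) !(deg_path_mor _ pab') /=.
  by rewrite cb' cb addnCA.
move=> _; rewrite !path_mor2 // => /factor_uniq[].
- by rewrite src_comp // rng_path_mor.
- by rewrite src_comp // rng_path_mor.
- by rewrite !deg_comp // !deg_edge cb' cb addrC.
- by apply/ffunP => i; rewrite (deg_path_mor _ pq) (deg_path_mor _ pq').
by move=> E _; split=> //; rewrite xE.
Qed.

Lemma step_allowable (u w : epath L) x : epath_rng u = epath_rng w ->
  sort_step w u x -> allowable u w x.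
Proof.
move=> uw wu; have [_ E] := sort_step_path (epathP w) wu.
split; first by rewrite /epi uw.
case: wu => [p [q [a [b [a' [b' [wE uE sq]]]]]]].
exists p, q, a, b, a', b'; split=> //; last exact: sq_mor sq.
by rewrite (sq_first sq) (sq_second sq) (sq_lt sq).
Qed.

Lemma transition_sum_sorting phi (w z : epath L) c : transition_sum phi w z c ->
  exists xs, sorting w z xs /\ c = weight phi xs.
Proof.
elim=> [|u {}z x d _ [xs [wu ->]] /allowable_step uz].
  by exists [::]; rewrite /weight big_nil; split=> //; exact: sorting_nil.
exists (xs ++ [:: x]); rewrite /weight big_cat big_seq1; split=> //.
exact: sorting_trans wu (sorting_cons uz (sorting_nil _)).
Qed.

(** [transition_sum] grows at its end and [sorting] at its beginning, whence the
    accumulated value [c] at an intermediate string [u] in the induction. *)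
Lemma sorting_transition_sum phi (w z : epath L) xs : epath_rng z = epath_rng w ->
  sorting w z xs -> transition_sum phi w z (weight phi xs).
Proof.
move=> zw; rewrite /weight.
suff H (u : epath L) c s t : sorting s t xs -> s = u -> t = z ->
    epath_rng u = epath_rng w -> transition_sum phi w u c ->
    transition_sum phi w z (c + \sum_(x <- xs) phi x).
  by move=> wz; rewrite -[X in transition_sum _ _ _ X]add0r;
     apply: (H _ _ _ _ wz erefl erefl erefl); exact: transition_sum0.
move=> st; elim: st u c => [{}s|{}s r {}t x ys sr _ IH] u c su tz uw cu.
  rewrite big_nil addr0; suff -> : z = u by [].
  by apply: epath_eq; rewrite ?zw ?uw // -su -tz.
rewrite su in sr; have [pr _] := sort_step_path (epathP u) sr.
rewrite big_cons addrA; apply: (IH (EPath pr)) => //.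
by apply: (transition_sumS cu); apply: step_allowable.
Qed.

Lemma S_phiE phi (w : epath L) xs : delta phi = 0 ->
  sorting w (bar (epi w)) xs -> S_phi phi w = weight phi xs.
Proof.
move=> phi0 wz; apply: xget_unique => [|c] /=.
  apply: sorting_transition_sum => //.
  by rewrite epath_rng_bar /epi rng_path_mor //; exact: epathP.
move=> /transition_sum_sorting[ys [wz' ->]].
exact: (weight_unique phi0 (epathP w) wz' (barP _).2 wz (barP _).2).
Qed.

Definition pair_fun m n : 'I_2 -> mor L := fun i => if i == ord0 then m else n.

Lemma pair_subproof m n : src m = rng n -> forall i j : 'I_2, j = i.+1 :> nat ->
  src (pair_fun m n i) = rng (pair_fun m n j).
Proof. by move=> mn [[|[|?]] ?] [[|[|?]] ?]. Qed.

Definition pair_tuple m n (mn : src m = rng n) : comptuple L 2 := CompTuple (pair_subproof mn).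

(** A categorical 2-cochain as a total function of two morphisms, to spare
    composability proofs in its arguments. *)
Definition pair_val (f : comptuple L 2 -> A) m n : A :=
  if pselect (src m = rng n) is left mn then f (pair_tuple mn) else 0.

Lemma pair_valE (f : comptuple L 2 -> A) (t : comptuple L 2) m n :
  t ord0 = m -> t ord_max = n ->
  f t = pair_val f m n.
Proof.
move=> <- <-; rewrite /pair_val; case: pselect => [mn|[]]; last exact: ctvalP.
congr f; apply: comptuple_eq => i; rewrite /= /pair_fun.
case: eqP => [->//|ne]; congr (ctval t _); apply: val_inj.
by case: i ne => [[|[|]]] //= ? [] //; exact: val_inj.
Qed.

Lemma cdelta2E (f : comptuple L 2 -> A) (t : comptuple L 3) l m n :
  t ord0 = l -> t (lift ord0 ord0) = m -> t ord_max = n ->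
  cdelta_fun f t =
  (pair_val f m n + pair_val f l (comp m n)) - (pair_val f (comp l m) n + pair_val f l m).
Proof.
move=> tl tm tn; rewrite /cdelta_fun !big_ord_recl big_ord0 addr0 /= /bump /=.
have E0 : widen_ord (leqnSn 2) ord0 = ord0 by exact: val_inj.
have E1 : widen_ord (leqnSn 2) ord_max = lift ord0 ord0 by exact: val_inj.
have E2 : lift ord0 (ord_max : 'I_2) = ord_max by exact: val_inj.
rewrite (pair_valE f (t := cface 0 t) (m := m) (n := n)); first last.
- by rewrite /= /cface_fun /= E2.
- by rewrite /= /cface_fun /=.
rewrite (pair_valE f (t := cface 1 t) (m := comp l m) (n := n)); first last.
- by rewrite /= /cface_fun /= E2.
- by rewrite /= /cface_fun /= E0 tl tm.
rewrite (pair_valE f (t := cface 2 t) (m := l) (n := comp m n)); first last.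
- by rewrite /= /cface_fun /= E1 E2 tm tn.
- by rewrite /= /cface_fun /= E0.
rewrite (pair_valE f (t := cface 3 t) (m := l) (n := m)); first last.
- by rewrite /= /cface_fun /= E1.
- by rewrite /= /cface_fun /= E0.
rewrite !exprS expr0 !mulr1 !mulN1r !opprK !mulrNz !mulr1z !opprD.
by rewrite !addrA [LHS](ACl (1*3*2*4)).
Qed.

End Potential.

(** * Equality of cohomology classes *)

Section CohomologyClass.
Variables (U V W : zmodType) (d1 : {additive U -> V}) (d2 : {additive V -> W}).

Lemma cocycle_valB (x y : cocycle d2) : sval (x - y) = sval x - sval y.
Proof. exact: (raddfB val x y). Qed.

Lemma cohomology_classP (x y : cocycle d2) :
  cohomology_class d1 x = cohomology_class d1 y <-> exists u, sval x = sval y + d1 u.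
Proof.
split=> [/eqP|[u xy]].
  rewrite -Quotient.idealrBE => /is_coboundaryP[u xy]; exists u.
  by rewrite -xy cocycle_valB addrC subrK.
apply/eqP; rewrite -Quotient.idealrBE; apply/is_coboundaryP; exists u.
by rewrite cocycle_valB xy addrC addKr.
Qed.

Lemma cohomology_class_surj (h : cohomology d1 d2) : exists z, cohomology_class d1 z = h.
Proof. by exists (repr h); exact: reprK. Qed.

Lemma cohomology_classB (x y : cocycle d2) :
  cohomology_class d1 (x - y) = cohomology_class d1 x - cohomology_class d1 y.
Proof. exact: raddfB. Qed.

End CohomologyClass.

(** * The cocycle [c_phi] *)

Section Psi.
Variables (k : nat) (L : kgraph k) (A : zmodType).
Implicit Types (e : edge L) (l m n : mor L) (s t p q : seq (edge L)).
Implicit Types (phi : cochain L A 2).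

Lemma bar_deg0 l : deg l = 0 -> bar l = [::] :> seq _.
Proof. by move=> l0; rewrite (@bar_eq _ _ (rng l) [::] l) //= -deg0_idm. Qed.

Lemma bar_sorted v s : is_path v s -> nondecreasing s ->
  bar (path_mor v s) = s :> seq _.
Proof. by move=> ps ss; rewrite -(bar_eq ps). Qed.

Lemma bar_edge e : bar (edge_mor e) = [:: e] :> seq _.
Proof.
by rewrite -(@bar_sorted (rng (edge_mor e)) [:: e]) //= comp_idr.
Qed.

Lemma c_phi_weight phi m n xs : delta phi = 0 -> src m = rng n ->
  sorting (bar m ++ bar n) (bar (comp m n)) xs ->
  pair_val (c_phi phi) m n = weight phi xs.
Proof.
move=> phi0 mn st; rewrite /pair_val; case: pselect => // mn'.
apply: S_phiE => //=; suff -> : epi (epath_cat (comptuple_bar (pair_tuple mn'))) = comp m n.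
  exact: st.
by rewrite /epi /= epath_rng_bar path_mor_bar_cat.
Qed.

Lemma c_phi_deg0 phi m n : delta phi = 0 -> src m = rng n ->
  deg m = 0 \/ deg n = 0 -> pair_val (c_phi phi) m n = 0.
Proof.
move=> phi0 mn mn0; rewrite (@c_phi_weight _ _ _ [::]) //; first by rewrite /weight big_nil.
suff -> : bar (comp m n) = bar m ++ bar n :> seq _ by exact: sorting_nil.
case: mn0 => d0; first by rewrite (bar_deg0 d0) (comp_deg0l mn d0).
by rewrite (bar_deg0 d0) (comp_deg0r mn d0) cats0.
Qed.

Lemma pair_normalized (f : comptuple L 2 -> A) :
  (forall m n, src m = rng n -> deg m = 0 \/ deg n = 0 -> pair_val f m n = 0) ->
  f \in @normalized k L A 2.
Proof.
move=> f0; apply/normalizedP => t [i ti]; rewrite (pair_valE f erefl erefl).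
apply: f0; first exact: ctvalP.
case: (eqVneq i ord0) => [<-|i0]; [by left | right].
by rewrite (_ : ord_max = i) //; apply: val_inj; case: i i0 {ti} => [[|[|]]].
Qed.

Lemma c_phi_normalized phi : delta phi = 0 -> c_phi phi \in @normalized k L A 2.
Proof. by move=> phi0; apply: pair_normalized => m n; exact: c_phi_deg0. Qed.

(** Both sides of the cocycle identity are weights of sortings of
    [bar l ++ bar m ++ bar n], which sort the first two or the last two factors
    first. *)
Lemma c_phi_cocycle phi : delta phi = 0 -> cdelta_fun (c_phi phi) = 0.
Proof.
move=> phi0; apply/funext => t; rewrite (cdelta2E _ erefl erefl erefl).
set l := t ord0; set m := t (lift ord0 ord0); set n := t ord_max.
have lm : src l = rng m by exact: ctvalP.
have mn : src m = rng n by exact: ctvalP.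
have l_mn : src l = rng (comp m n) by rewrite rng_comp.
have lm_n : src (comp l m) = rng n by rewrite src_comp.
have [xs1 st1] := sorting_bar_cat mn; have [xs2 st2] := sorting_bar_cat l_mn.
have [xs3 st3] := sorting_bar_cat lm; have [xs4 st4] := sorting_bar_cat lm_n.
rewrite (c_phi_weight phi0 mn st1) (c_phi_weight phi0 l_mn st2).
rewrite (c_phi_weight phi0 lm st3) (c_phi_weight phi0 lm_n st4).
have right := sorting_trans (sorting_catl (bar l) st1) st2.
have left := sorting_trans (sorting_catr (bar n) st3) st4.
rewrite comp_assoc // catA in right.
have plmn : is_path (rng l) ((bar l ++ bar m) ++ bar n).
  apply/is_path_cat; split; first exact: bar_cat_path.
  by rewrite path_mor_bar_cat // src_comp // mn; exact: bar_path.
have := weight_unique phi0 plmn right (barP _).2 left (barP _).2.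
by rewrite /weight !big_cat /= => ->; rewrite addrC subrr.
Qed.

Lemma Z2_delta (z : Z2 L A) : delta (Z2_val z) = 0.
Proof. exact/eqP/(svalP z). Qed.

Definition c_cochain (z : Z2 L A) : ccochain L A 2 :=
  exist _ (c_phi (Z2_val z)) (c_phi_normalized (Z2_delta z)).

Lemma c_cochain_cocycle z : c_cochain z \in is_cocycle (@cdelta k L A 2).
Proof. apply/eqP; apply: val_inj; exact: c_phi_cocycle (Z2_delta z). Qed.

Definition c_map (z : Z2 L A) : cZ2 L A := exist _ (c_cochain z) (c_cochain_cocycle z).

Lemma pair_val_inj (f g : comptuple L 2 -> A) :
  (forall m n, src m = rng n -> pair_val f m n = pair_val g m n) -> f = g.
Proof.
move=> fg; apply/funext => t; rewrite !(pair_valE _ erefl erefl); apply: fg.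
exact: ctvalP.
Qed.

Lemma pair_valD (f g : comptuple L 2 -> A) m n :
  pair_val (f + g) m n = pair_val f m n + pair_val g m n.
Proof. by rewrite /pair_val; case: pselect => // _; rewrite addr0. Qed.

Lemma cZ2_val_inj : injective (@cZ2_val k L A).
Proof. by move=> w w' E; apply: val_inj; apply: val_inj. Qed.

Lemma ccochain_valD r (c c' : ccochain L A r) : sval (c + c') = sval c + sval c'.
Proof. exact: (raddfD val c c'). Qed.

Lemma cZ2_valD (w w' : cZ2 L A) : cZ2_val (w + w') = cZ2_val w + cZ2_val w'.
Proof.
rewrite -[RHS]/(sval (sval w) + sval (sval w')) -ccochain_valD.
by congr sval; exact: (raddfD val w w').
Qed.

Lemma c_mapD z z' : c_map (z + z') = c_map z + c_map z'.
Proof.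
apply: cZ2_val_inj; rewrite cZ2_valD.
apply: pair_val_inj => m n mn.
have [xs st] := sorting_bar_cat mn; rewrite pair_valD.
rewrite !(@c_phi_weight _ _ _ xs) //; try exact: Z2_delta.
exact: weightD.
Qed.

Lemma single_subproof l (i j : 'I_1) : j = i.+1 :> nat -> src l = rng l.
Proof. by case: j => [[]]. Qed.

Definition single l : comptuple L 1 := @CompTuple k L 1 (fun=> l) (single_subproof l).

Lemma single_eq (t : comptuple L 1) l : t ord0 = l -> t = single l.
Proof. by move=> <-; apply: comptuple_eq => i; rewrite ord1. Qed.

Lemma cdelta1E (f : comptuple L 1 -> A) m n : src m = rng n ->
  pair_val (cdelta_fun f) m n =
  (f (single m) + f (single n)) - f (single (comp m n)).
Proof.
move=> mn; rewrite /pair_val; case: pselect => // mn'.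
rewrite /cdelta_fun !big_ord_recl big_ord0 addr0 /=.
rewrite (@single_eq (cface 0 _) n) // (@single_eq (cface 1 _) (comp m n)) //.
rewrite (@single_eq (cface 2 _) m) //.
rewrite /bump !exprS expr0 !mulr1 !mulN1r !opprK !mulrNz !mulr1z.
by rewrite !addrA [LHS](ACl (3*1*2)).
Qed.

Lemma mor_normalized (g : mor L -> A) : (forall l, deg l = 0 -> g l = 0) ->
  (fun t : comptuple L 1 => g (t ord0)) \in @normalized k L A 1.
Proof. by move=> g0; apply/normalizedP => t [i]; rewrite ord1; exact: g0. Qed.

(** Normalised categorical 1-cochains are the functions on morphisms that
    vanish on the identities. *)
Lemma mor_coboundary (g : mor L -> A) : (forall l, deg l = 0 -> g l = 0) ->
  exists u : ccochain L A 1, forall m n, src m = rng n ->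
    pair_val (sval (cdelta u)) m n = (g m + g n) - g (comp m n).
Proof.
move=> /mor_normalized g0.
exists (exist (fun f => is_true (f \in @normalized k L A 1)) _ g0) => m n mn.
by rewrite cdelta1E.
Qed.

Lemma c_phi_potential phi (T : seq (edge L) -> A) m n : delta phi = 0 ->
  (forall v s t x, is_path v s -> sort_step s t x -> phi x = T s - T t) ->
  src m = rng n ->
  pair_val (c_phi phi) m n = T (bar m ++ bar n) - T (bar (comp m n)).
Proof.
move=> phi0 HT mn; have [xs st] := sorting_bar_cat mn.
by rewrite (c_phi_weight phi0 mn st); apply: (weight_potential HT (bar_cat_path mn) st).
Qed.

(** * Well-definedness and injectivity of [psi] *)

Lemma c_map_coboundary z f : Z2_val z = delta f ->
  exists u, sval (c_map z) = cdelta u.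
Proof.
move=> zf; pose T s := - \sum_(e <- s) f e.
have [|u uE] := @mor_coboundary (fun l => T (bar l)).
  by move=> l l0; rewrite bar_deg0 // /T big_nil oppr0.
exists u; apply: val_inj; apply: pair_val_inj => m n mn; rewrite uE //=.
rewrite (c_phi_potential (T := T)) ?Z2_delta //; first by rewrite {1}/T big_cat opprD.
move=> v s t x _ [p [q [a [b [a' [b' [-> -> sq]]]]]]].
rewrite zf (delta1_square _ sq) /T !big_cat !big_cons /= opprK [RHS]addrC !opprD !addrA.
rewrite [RHS](ACl ((1*5)*(4*8)*2*3*6*7)) /= !subrr add0r.
by rewrite add0r.
Qed.

(** [bar a' ++ bar b'] is sorted by one step and [bar a ++ bar b] by none, so
    that [phi] can be recovered from [c_phi]. *)
Lemma c_phi_square phi a b a' b' x : delta phi = 0 -> square a b a' b' x ->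
  phi x = pair_val (c_phi phi) (edge_mor a') (edge_mor b')
        - pair_val (c_phi phi) (edge_mor a) (edge_mor b).
Proof.
move=> phi0 sq; have ab := sq_comp sq; have ab' := sq_comp' sq.
have barE : bar (comp (edge_mor a) (edge_mor b)) = [:: a; b] :> seq _.
  rewrite -(@bar_sorted (rng (edge_mor a)) [:: a; b]) //=; last first.
    by rewrite /nondecreasing /= ltnW ?(sq_lt sq).
  by rewrite comp_idr.
rewrite (@c_phi_weight _ _ _ [:: x]) //; last first.
  rewrite !bar_edge -(sq_mor' sq) (sq_mor sq) barE.
  exact: (sorting_square [::] [::] sq).
rewrite (@c_phi_weight _ (edge_mor a) _ [::]) //; last first.
  by rewrite !bar_edge barE; exact: sorting_nil.
by rewrite /weight big_nil big_seq1 subr0.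
Qed.

(** The value at the composite of the square is the same for its two
    factorisations and cancels in the difference given by [c_phi_square]. *)
Lemma c_map_coboundary_inv z u : sval (c_map z) = cdelta u ->
  exists f, Z2_val z = delta f.
Proof.
move=> zu; pose g l := sval u (single l).
have cE m n : src m = rng n ->
    pair_val (c_phi (Z2_val z)) m n = (g m + g n) - g (comp m n).
  by move=> mn; rewrite -cdelta1E // -[cdelta_fun _]/(sval (cdelta u)) -zu.
exists (fun e => - g (edge_mor e)); apply/funext => x.
have [a [b [a' [b' sq]]]] := cube2_square x.
rewrite (c_phi_square (Z2_delta z) sq) (delta1_square _ sq).
rewrite !cE ?(sq_comp sq) ?(sq_comp' sq) //.
rewrite -(sq_mor sq) -(sq_mor' sq) opprB addrA subrK.
by rewrite [RHS]addrC !opprD !opprK.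
Qed.

(** * Surjectivity of [psi] *)

Section Surjectivity.
Variable c : ccochain L A 2.
Hypothesis c_cocycle : cdelta c = 0.
Let F m n := pair_val (sval c) m n.

Lemma triple_subproof l m n : src l = rng m -> src m = rng n ->
  forall i j : 'I_3, j = i.+1 :> nat ->
  src (nth l [:: l; m; n] i) = rng (nth l [:: l; m; n] j).
Proof. by move=> lm mn [[|[|[|?]]] ?] [[|[|[|?]]] ?]. Qed.

Lemma cocycle_identity l m n : src l = rng m -> src m = rng n ->
  F m n + F l (comp m n) = F (comp l m) n + F l m.
Proof.
move=> lm mn; pose t : comptuple L 3 := CompTuple (triple_subproof lm mn).
apply/eqP; rewrite -subr_eq0 -(@cdelta2E _ _ _ (sval c) t) //.
by rewrite -[cdelta_fun _ _]/(sval (cdelta c) t) c_cocycle.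
Qed.

Lemma cocycle_deg0 m n : src m = rng n -> deg m = 0 \/ deg n = 0 -> F m n = 0.
Proof.
move=> mn mn0; rewrite /F /pair_val; case: pselect => // mn'.
apply: (normalizedP _ (svalP c)).
by case: mn0; [exists ord0 | exists ord_max].
Qed.

(** The defect of [c] along a string: if [c] were the coboundary of [g], this
    would be the sum of [g] over the edges minus [g] of the composite, up to the
    value of [g] on the empty string, which is zero. *)
Fixpoint string_sum s : A :=
  if s is e :: s' then F (edge_mor e) (path_mor (src (edge_mor e)) s') + string_sum s'
  else 0.

(** Induction on [s]; moving an edge [e] across is the cocycle identity for
    [e], the rest of [s], and [t]. *)
Lemma string_sum_cat v s t : is_path v (s ++ t) ->
  string_sum (s ++ t) =
  string_sum s + string_sum t + F (path_mor v s) (path_mor (src (path_mor v s)) t).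
Proof.
elim: s v => [|e s IH] v pst /=.
  rewrite cocycle_deg0 ?add0r ?addr0 //; last by left; exact: deg_idm.
  by rewrite src_idm rng_path_mor.
have [_ pst'] := pst; have /is_path_cat[ps pt] := pst'.
have es := esym (rng_path_mor ps).
rewrite (IH _ pst') path_mor_cat // src_comp //.
have := cocycle_identity es (esym (rng_path_mor pt)) => E.
rewrite [LHS](AC (1*3) ((4*1)*2*3)) /= E.
by rewrite [LHS](ACl ((2*3)*4*1)).
Qed.

(** The value prescribed by [c_phi_square]: in terms of the square [a b = a' b']
    this is [c (a', b') - c (a, b)], see [cube_cochain_square]. *)
Definition cube_cochain : cochain L A 2 := fun x =>
  F (sval (face x ord0 false)) (sval (face x ord_max true))
  - F (sval (face x ord_max false)) (sval (face x ord0 true)).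

Lemma cube_cochain_square a b a' b' x : square a b a' b' x ->
  cube_cochain x = F (edge_mor a') (edge_mor b') - F (edge_mor a) (edge_mor b).
Proof. by move=> /square_faces[F00 F01 F10 F11]; rewrite /cube_cochain F00 F01 F10 F11. Qed.

Lemma string_sum_pair a b s : is_path (rng (edge_mor a)) [:: a, b & s] ->
  string_sum [:: a, b & s] = F (edge_mor a) (edge_mor b) + string_sum s
    + F (comp (edge_mor a) (edge_mor b)) (path_mor (src (edge_mor b)) s).
Proof.
move=> ps; have [_ [ab ps']] := ps.
rewrite (@string_sum_cat _ [:: a; b] s ps) /=.
rewrite (cocycle_deg0 (_ : src (edge_mor b) = _)) ?rng_idm //; last by right; exact: deg_idm.
by rewrite !comp_idr !addr0 src_comp.
Qed.

Lemma string_sum_potential v s t x : is_path v s -> sort_step s t x ->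
  cube_cochain x = string_sum s - string_sum t.
Proof.
move=> ps st; have [pt _] := sort_step_path ps st.
case: st => [p [q [a [b [a' [b' [sE tE sq]]]]]]]; rewrite sE tE in ps pt *.
rewrite (cube_cochain_square sq) (string_sum_cat ps) (string_sum_cat pt).
have /is_path_cat[_ ps'] := ps; have /is_path_cat[_ pt'] := pt.
have E : comp (edge_mor a) (edge_mor b) = comp (edge_mor a') (edge_mor b').
  by rewrite -(sq_mor sq) (sq_mor' sq).
have src_b : src (edge_mor b) = src (edge_mor b').
  by rewrite -(src_comp (sq_comp sq)) E src_comp // (sq_comp' sq).
rewrite !path_mor2 //.
have [ra _] := ps'; have [ra' _] := pt'.
rewrite -ra in ps'; rewrite -ra' in pt'.
rewrite (string_sum_pair ps') (string_sum_pair pt') E src_b.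
set X := F _ _; set Y := F _ _; set Z := F _ _; set S := string_sum q.
set P := string_sum p; set R := F (path_mor v p) _.
rewrite [P + (X + S + Z) + R](AC ((1*(3))*1) (2*(1*3*4*5))).
rewrite [P + (Y + S + Z) + R](AC ((1*(3))*1) (2*(1*3*4*5))).
by rewrite opprD addrACA subrr addr0.
Qed.

(** On a 3-cube the coboundary is the difference of the weights of two
    sortings of the same string with the same end, which the potential makes
    equal. *)
Lemma cube_cochain_cocycle : delta cube_cochain = 0.
Proof.
apply/funext => x; have [e3 [e2 [e1 [c32 c21 lt12 lt23 xE]]]] := cube3_edges x.
have [f2 [f3 [x1 sx]]] := square_exists c32 lt23.
have [k1 [k2 [y1 sy]]] := square_exists c21 lt12.
have [t [x2 [x3 [y2 [y3 [x' [tx ty xE' /(_ A cube_cochain)]]]]]]] := hexagon sx sy.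
have -> : x' = x by apply: val_inj; rewrite /= xE.
move=> ->.
have P0 : is_path (rng (edge_mor e3)) [:: e3; e2; e1] by [].
have TX := sorting_trans (sorting_square [::] [:: e1] sx) tx.
have TY := sorting_trans (sorting_square [:: e3] [::] sy) ty.
have := weight_potential string_sum_potential P0 TX.
rewrite -(weight_potential string_sum_potential P0 TY) /weight !big_cons !big_nil !addr0.
by move=> ->; rewrite subrr.
Qed.

Lemma c_phi_cube_cochain : exists u, c_phi cube_cochain = sval (c + cdelta u).
Proof.
have [|u uE] := @mor_coboundary (fun l => string_sum (bar l)).
  by move=> l /bar_deg0 ->.
exists u; apply: pair_val_inj => m n mn.
rewrite ccochain_valD pair_valD uE // -/(F m n).
rewrite (c_phi_potential cube_cochain_cocycle string_sum_potential mn).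
rewrite (string_sum_cat (bar_cat_path mn)) !path_mor_bar mn path_mor_bar addrA.
by congr (_ - _); rewrite addrC.
Qed.

End Surjectivity.

Lemma c_map_surj (w : cZ2 L A) : exists z u, sval w = sval (c_map z) + cdelta u.
Proof.
have w0 : cdelta (sval w) = 0 by exact/eqP/(svalP w).
have zP : cube_cochain (sval w) \in is_cocycle (@delta k L A 2).
  exact/eqP/cube_cochain_cocycle.
have [u cE] := c_phi_cube_cochain w0.
have [z zw] : exists z : Z2 L A, Z2_val z = cube_cochain (sval w).
  by exists (exist (fun phi => is_true (phi \in is_cocycle (@delta k L A 2))) _ zP).
exists z, (- u).
have zE : sval (c_map z) = sval w + cdelta u by apply: val_inj; rewrite /= zw.
by rewrite zE raddfN addrK.
Qed.

(** * The isomorphism *)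

Definition psi (h : H2 L A) : cH2 L A := cH2_class (c_map (repr h)).

Lemma c_mapB : {morph c_map : x y / x - y}.
Proof. by move=> x y; apply/eqP; rewrite eq_sym subr_eq -c_mapD subrK. Qed.

(** One direction makes [psi] well defined, the other makes it injective. *)
Lemma classes_eq z z' :
  H2_class z = H2_class z' <-> cH2_class (c_map z) = cH2_class (c_map z').
Proof.
split=> /cohomology_classP[u zu]; apply/cohomology_classP.
  have [|u' cu] := @c_map_coboundary (z - z') u.
    by rewrite /Z2_val cocycle_valB zu addrC addKr.
  by exists u'; move/eqP: cu; rewrite c_mapB cocycle_valB subr_eq addrC => /eqP.
have [|f zf] := @c_map_coboundary_inv (z - z') u.
  by rewrite c_mapB cocycle_valB zu addrC addKr.
by exists f; move/eqP: zf; rewrite /Z2_val cocycle_valB subr_eq addrC => /eqP.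
Qed.

Lemma psiE z : psi (H2_class z) = cH2_class (c_map z).
Proof. by apply/classes_eq; exact: reprK. Qed.

Lemma psi_zmod_morphism : zmod_morphism psi.
Proof.
move=> h h'; have [z <-] := cohomology_class_surj h.
have [z' <-] := cohomology_class_surj h'.
rewrite -cohomology_classB -!/(H2_class _) !psiE c_mapB; exact: cohomology_classB.
Qed.

HB.instance Definition _ := GRing.isZmodMorphism.Build _ _ psi psi_zmod_morphism.

Lemma psi_bij : bijective psi.
Proof.
have psi_inj : injective psi.
  move=> h h'; have [z <-] := cohomology_class_surj h.
  have [z' <-] := cohomology_class_surj h'.
  by rewrite -!/(H2_class _) !psiE => /classes_eq.
have psi_surj d : exists h, psi h = d.
  have [w <-] := cohomology_class_surj d; have [z [u wE]] := c_map_surj w.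
  by exists (H2_class z); rewrite psiE; apply/esym/cohomology_classP; exists u.
have [g gK] := choice psi_surj.
by exists g => // h; apply: psi_inj; rewrite gK.
Qed.

End Psi.

Theorem theorem4p15 (k : nat) (L : kgraph k) (A : zmodType) :
  exists (c : Z2 L A -> cZ2 L A) (psi : {additive H2 L A -> cH2 L A}),
    [/\ forall phi : Z2 L A, cZ2_val (c phi) = c_phi (Z2_val phi),
        forall phi : Z2 L A, psi (H2_class phi) = cH2_class (c phi)
      & bijective psi].
Proof.
by exists (@c_map k L A), (@psi k L A); split=> //; [exact: psiE | exact: psi_bij].
Qed.
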